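(* Let $\nu$ be a finite non-zero Borel measure on $(0,1)$ and let $T_\nu$ be the polyharmonic operator for $\ell=m=1$. A real number $\lambda>0$ is an eigenvalue of $T_\nu$ if and only if $1/\lambda$ is an eigenvalue of the Kreĭn–Feller problem $$\int_{(0,1)}\nabla f\,\nabla u\,d\Lambda=\mu\int fu\,d\nu\quad\text{for all }f\in\operatorname{dom}(\mathcal E_\nu),$$ that is, if and only if there is $u\in\operatorname{dom}(\mathcal E_\nu)\setminus\{0\}$ satisfying this identity with $\mu=1/\lambda$.
   Context: $\Lambda$ is Lebesgue measure, $\nabla$ the weak derivative, and $H_0^1$ the closure of $\mathcal C_c^\infty((0,1))$ in $W_2^1((0,1))$ (real-valued functions), identified with continuous functions on $[0,1]$ vanishing at $0$ and $1$. $\operatorname{supp}(\nu)$ denotes the support of $\nu$ as a closed subset of $[0,1]$. $\mathcal C_\nu([0,1])$ is the set of $f\in\mathcal C([0,1])$ that are affine linear on the connected components of $[0,1]\setminus\operatorname{supp}(\nu)$, and $\operatorname{dom}(\mathcal E_\nu)=H_0^1\cap\mathcal C_\nu([0,1])$. $T_\nu$ is the compact non-negative self-adjoint operator on $H_0^1$ with inner product $I_1(u,v)=\int_{(0,1)}\nabla u\,\nabla v\,d\Lambda$ determined by $\int uw\,d\nu=I_1(T_\nu u,w)$ for all $u,w\in H_0^1$. Thus $\lambda$ is an eigenvalue of $T_\nu$ with eigenfunction $\varphi\in H_0^1\setminus\{0\}$ iff $\int\varphi g\,d\nu=\lambda\int_{(0,1)}\nabla\varphi\,\nabla g\,d\Lambda$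 for all $g\in H_0^1$. *)

(* Defs.v *)
From HB Require Import structures.
From mathcomp Require Import all_boot all_order all_algebra.
From mathcomp Require Import all_classical all_reals all_analysis.

Set Implicit Arguments.
Unset Strict Implicit.
Unset Printing Implicit Defensive.
Import Order.TTheory GRing.Theory Num.Theory.
Import numFieldNormedType.Exports.

Local Open Scope classical_set_scope.
Local Open Scope ring_scope.

Section Sobolev.
Context {R : realType}.
Implicit Types f g u v phi : R -> R.

Local Notation Lambda := (@lebesgue_measure R).
Local Notation I01 := (`]0, 1[%classic : set R).

(* An element of C_c^oo((0,1)) is represented by its extension by zero to R. *)
Definition test_function phi : Prop :=
  [/\ forall (n : nat) (x : R), derivable (derive1n n phi) x 1,
      compact (closure [set x | phi x != 0]) &
      closure [set x | phi x != 0] `<=` I01].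

Definition weak_derivative f g : Prop :=
  [/\ locally_integrable I01 f, locally_integrable I01 g &
      forall phi, test_function phi ->
        \int[Lambda]_(x in I01) (f x * derive1 phi x) =
        - \int[Lambda]_(x in I01) (g x * phi x)].

(* The weak derivative is unique Lambda-almost everywhere on (0,1); [wgrad f]
   is a chosen representative of it, and 0 if [f] has no weak derivative. *)
Definition wgrad f : R -> R := xget (cst 0) [set g | weak_derivative f g].

Definition L2 f : Prop := f \_ I01 \in Lfun Lambda 2%:E.

Definition L2norm f : R := fine ('N[Lambda]_2%:E[EFin \o (f \_ I01)]).

Definition W12 f : Prop :=
  [/\ L2 f, exists g, weak_derivative f g & L2 (wgrad f)].

Definition W12norm f : R := Num.sqrt (L2norm f ^+ 2 + L2norm (wgrad f) ^+ 2).

(* A continuous function on [0,1] vanishing at 0 and 1 is represented by its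
   extension by zero to R; in this way each class in H_0^1 has exactly one
   representative, so that equality in H_0^1 is equality of functions. *)
Definition H01 u : Prop :=
  [/\ continuous u,
      forall x, ~ I01 x -> u x = 0,
      W12 u &
      forall eps, 0 < eps ->
        exists2 phi, test_function phi & W12norm (u \- phi) < eps].

Definition I1 u v : R := \int[Lambda]_(x in I01) (wgrad u x * wgrad v x).

End Sobolev.

Section KreinFeller.
Context {R : realType}.
(* Borel measures on (0,1) are represented by Borel measures on R for which
   the complement of (0,1) is a null set. *)
Variable nu : {finite_measure set (measurableTypeR R) -> \bar R}.
Implicit Types f u v w : R -> R.

Local Notation I01 := (`]0, 1[%classic : set R).

(* The closed support of [nu]; it may contain the endpoints 0 and 1. *)
Definition supp : set R :=
  [set x | x \in `[0, 1] /\
           forall U : set R, open U -> U x -> (0 < nu U)%E].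

Definition C_nu f : Prop :=
  {within `[0, 1]%classic, continuous f} /\
  forall x, (`[0, 1]%classic `\` supp) x ->
    exists a b : R, forall y,
      connected_component (`[0, 1]%classic `\` supp) x y -> f y = a * y + b.

Definition dom_E f : Prop := H01 f /\ C_nu f.

Definition nu_form u w : R := \int[nu]_(x in I01) (u x * w x).

(* [T_nu u] is the unique [v] in H_0^1 representing the bounded linear
   functional [w |-> int u w dnu] with respect to [I1]. *)
Definition T_nu u : R -> R :=
  xget (cst 0)
    [set v | H01 v /\ forall w, H01 w -> nu_form u w = I1 v w].

Definition krein_feller_eigenvalue (mu : R) : Prop :=
  exists u, [/\ dom_E u, u <> cst 0 &
    forall f, dom_E f -> I1 f u = mu * nu_form f u].

End KreinFeller.

Definition H01_eigenvalue {R : realType} (T : (R -> R) -> (R -> R))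
    (lambda : R) : Prop :=
  exists phi : R -> R,
    [/\ H01 phi, phi <> cst 0 & T phi = (fun x => lambda * phi x)].

(* Main.v *)
Require Import Defs.
From HB Require Import structures.
From mathcomp Require Import all_boot all_order all_algebra.
From mathcomp Require Import all_classical all_reals all_analysis.
From mathcomp Require Import measurable_realfun ring lra.
Import Order.TTheory GRing.Theory Num.Theory.
Import numFieldNormedType.Exports.

Set Implicit Arguments.
Unset Strict Implicit.
Unset Printing Implicit Defensive.

Local Open Scope classical_set_scope.
Local Open Scope ring_scope.

(** Why the statement holds.

    The operator can be written down.  Put [U(x)], the integral of [u] over
    (0, x) with respect to [nu], and [c], the mean of [U] over (0, 1).  The
    function [green u] with slope [c - U] that vanishes at 0 and 1 lies in
    H_0^1, and integrating over the triangle [y < x] in the two possible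
    orders gives [I1 (green u) w = nu_form u w] for every [w] in H_0^1
    ([I1_green]).  As [I1] is positive definite on H_0^1, this identifies
    [T_nu u] with [green u] ([T_nuE]).

    The formula also shows where [green u] lives: on an interval that avoids
    the support of [nu] the function [U] does not change, so [green u] has
    constant slope there, and hence [green u] belongs to [dom_E nu] whatever
    [u] in H_0^1 is ([green_dom_E]).  Both implications follow.  An
    eigenfunction [phi] equals [lambda^-1 * green phi], so it is in the domain
    and satisfies the identity even against all of H_0^1.  Conversely, if [u]
    solves the problem on the domain, then [green u - lambda * u] is an element
    of the domain which is [I1]-orthogonal to the domain, itself included, so
    it is zero.

    The rest makes H_0^1 usable.  [has_slope w g] says that [w] is the
    primitive of [g], vanishes off (0, 1), and that [g] is an L^2 limit of
    derivatives of test functions; [H01_has_slope] and [has_slope_H01] show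
    that H_0^1 consists of exactly such functions, with [g] almost everywhere
    the weak derivative of [w].  This needs that weak derivatives are unique
    ([weak_derivative_unique]), that primitives have weak derivatives
    ([is_primitive_weak_derivative], again the triangle), and that [U] is an
    L^2 limit of test functions ([approximable_mass_below], through step
    functions).  Test functions are supplied by products of two copies of
    exp(-1/x): sharpened, they converge boundedly to the indicator of an
    interval, so that dominated convergence replaces mollification. *)

(** * Smooth functions and exp(-1/x) *)

Section Smooth.
Context {R : realType}.
Implicit Types (f g : R -> R) (n k : nat) (a b x : R).

Definition smooth f : Prop := forall n x, derivable (derive1n n f) x 1.

(** Existence of [n] successive derivatives, in a form suited to induction on
    [n]: the derivative is a witness rather than the total operator
    [derive1]. *)
Fixpoint ndiff n f : Prop :=
  if n is m.+1 then
    exists2 g, forall x, is_derive x (1 : R) f (g x) & ndiff m g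
  else True.

Lemma is_derive_derive1 f g : (forall x, is_derive x (1 : R) f (g x)) ->
  derive1 f = g.
Proof.
by move=> fg; apply/funext => x; rewrite derive1E; exact: derive_val.
Qed.

Lemma smoothP f : smooth f <-> forall n, ndiff n f.
Proof.
split=> [sf n|].
- elim: n f sf => //= n IH f sf; exists (derive1 f).
    move=> x; rewrite derive1E; apply: DeriveDef => //.
    exact: (sf 0%N).
  by apply: IH => m x; rewrite -derive1Sn; exact: sf.
- move=> + n; elim: n f => [|n IH] f nf x.
    by have [g fg _] := nf 1%N; exact: ex_derive.
  rewrite derive1Sn; apply: IH => m.
  by have [g fg gm] := nf m.+1; rewrite (is_derive_derive1 fg).
Qed.

Lemma ndiffW n f : ndiff n.+1 f -> ndiff n f.
Proof. by elim: n f => // n IH f [g fg gn]; exists g => //; exact: IH. Qed.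

Lemma ndiff_cst n (c : R) : ndiff n (cst c).
Proof. by elim: n c => // n IH c; exists (cst 0); [move=> x;
  exact: is_derive_cst|exact: IH]. Qed.

Lemma ndiffD n f g : ndiff n f -> ndiff n g -> ndiff n (f \+ g).
Proof.
elim: n f g => // n IH f g [f' ff' nf'] [g' gg' ng'].
exists (f' \+ g'); last exact: IH.
by move=> x; apply: is_deriveD.
Qed.

(** The product rule reduces order [n.+1] for a product to order [n] for two
    products, one factor of which has one more derivative than is used. *)
Lemma ndiffM n f g : ndiff n f -> ndiff n g -> ndiff n (f \* g).
Proof.
elim: n f g => // n IH f g nf ng.
have [[f' ff' nf'] [g' gg' ng']] := (nf, ng).
exists ((f \* g') \+ (g \* f')).
  by move=> x; apply: is_deriveM.
by apply: ndiffD; apply: IH => //; exact: ndiffW.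
Qed.

Lemma ndiff_affine n f a b : ndiff n f -> ndiff n (fun x => f (a * x + b)).
Proof.
elim: n f => // n IH f [f' ff' nf'].
exists (cst a \* (fun x => f' (a * x + b))).
  move=> x; have H : is_derive x (1 : R) (fun x => a * x + b) a.
    rewrite (_ : (fun x => _) = (cst a * id + cst b)%R); last exact/funext.
    by apply: is_derive_eq; rewrite /GRing.scale/= !mulr0 mulr1 !addr0.
  have := @is_derive1_comp _ f (fun x => a * x + b) x _ _ (ff' _) H.
  by rewrite mulrC.
by apply: ndiffM; [exact: ndiff_cst|exact: IH].
Qed.

Lemma smoothD f g : smooth f -> smooth g -> smooth (f \+ g).
Proof. by rewrite !smoothP => sf sg n; exact: ndiffD. Qed.

Lemma smoothM f g : smooth f -> smooth g -> smooth (f \* g).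
Proof. by rewrite !smoothP => sf sg n; exact: ndiffM. Qed.

Lemma smooth_cst (c : R) : smooth (cst c).
Proof. by rewrite smoothP => n; exact: ndiff_cst. Qed.

Lemma smooth_affine f a b : smooth f -> smooth (fun x => f (a * x + b)).
Proof. by rewrite !smoothP => sf n; exact: ndiff_affine. Qed.

Lemma smooth_derive1 f : smooth f -> smooth (derive1 f).
Proof. by move=> sf n x; rewrite -derive1Sn; exact: sf. Qed.

Lemma smooth_primitive f g : (forall x, is_derive x (1 : R) f (g x)) ->
  smooth g -> smooth f.
Proof.
move=> fg; rewrite !smoothP => sg [//|n]; exists g => //.
Qed.

Lemma smooth_is_derive f x : smooth f -> is_derive x 1 f (derive1 f x).
Proof.
move=> sf; rewrite derive1E; apply: DeriveDef => //; exact: (sf 0%N).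
Qed.

Lemma smooth_continuous f : smooth f -> continuous f.
Proof.
move=> sf x; apply: differentiable_continuous; apply/derivable1_diffP.
exact: (sf 0%N).
Qed.

(** The functions x^-k exp(-1/x), extended by zero.  The family is closed
    under derivation up to linear combinations, which is what makes the
    induction for smoothness run. *)
Definition flat k x : R := if 0 < x then x^-1 ^+ k * expR (- x^-1) else 0.

(** Flatness at 0: exp(1/x) dominates the term of degree [k.+2] of its power
    series. *)
Lemma flat_le k x : 0 <= flat k x <= k.+2`!%:R * x ^+ 2.
Proof.
rewrite /flat; case: ifPn => [x0|_]; last by rewrite lexx mulr_ge0// sqr_ge0.
have y0 : 0 < x^-1 by rewrite invr_gt0.
apply/andP; split; first by rewrite mulr_ge0 ?expR_ge0// exprn_ge0// ltW.
have := @expR_ge1Dxn R x^-1 k.+1 (ltW y0).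
rewrite expRN ler_pdivrMr ?expR_gt0// => h.
apply: (@le_trans _ _ (k.+2`!%:R * x ^+ 2 * (x^-1 ^+ k.+2 / k.+2`!%:R))).
  rewrite le_eqVlt; apply/orP; left; apply/eqP.
  rewrite -(addn2 k) exprD; field.
  by rewrite ?pnatr_eq0 -?lt0n ?fact_gt0 ?(gt_eqF x0)// (gt_eqF x0).
apply: ler_wpM2l; first by rewrite mulr_ge0// sqr_ge0.
by apply: le_trans h; rewrite lerDr.
Qed.

Lemma flatS k x : flat k x = flat k.+1 x * x.
Proof.
rewrite /flat; case: ifPn => [x0|_]; last by rewrite mul0r.
rewrite exprS; set z := _ ^+ k; set e := expR _; field.
by rewrite gt_eqF.
Qed.

Lemma flat0 k : flat k 0 = 0. Proof. by rewrite /flat ltxx. Qed.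

Lemma flat_cvg0 k : flat k x @[x --> (0 : R)] --> (0 : R).
Proof.
apply: (@squeeze_cvgr _ _ _ _ (cst 0) (fun x => k.+2`!%:R * x ^+ 2)).
- by near=> x; exact: flat_le.
- exact: cvg_cst.
- rewrite -[X in _ --> X](mulr0 (k.+2`!%:R : R)); apply: cvgMr.
  rewrite -[X in _ --> X](expr0n R 2); exact: exprn_continuous.
Unshelve. all: by end_near. Qed.

Lemma is_derive_flat k x :
  is_derive x (1 : R) (flat k) (flat k.+2 x - k%:R * flat k.+1 x).
Proof.
have [x0|x0|->] := ltgtP x 0.
- rewrite /flat !ltNge (ltW x0)/= mulr0 subr0.
  apply: (@near_eq_is_derive _ _ _ (cst 0)).
  near=> y; rewrite /flat ifF//; apply/negbTE; rewrite -leNgt ltW//.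
  near: y; exact: lt_nbhsl.
- apply: (@near_eq_is_derive _ _ _ (fun x => x^-1 ^+ k * expR (- x^-1))).
    near=> y; rewrite /flat ifT//; near: y; exact: lt_nbhsr.
  have xn0 : x != 0 by rewrite gt_eqF.
  have H : is_derive x (1 : R) (fun y : R => y^-1) (- x ^- 2 *: 1).
    by have := @is_deriveV R id x 1 1 xn0 (is_derive_id _ _).
  have HX := is_deriveX k H.
  have HN := is_deriveN H.
  have HE := @is_derive1_comp _ expR (fun y => - y^-1) x _ _ (is_derive_expR _)
    HN.
  rewrite (_ : (fun x => _) = ((fun y : R => y^-1) ^+ k) * (expR \o (fun y => -
    y^-1))); last first.
    by apply/funext => y; rewrite exprfctE.
  apply: (is_derive_eq (is_deriveM HX HE)).
  rewrite /flat x0 /GRing.scale/= fctE.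
  case: k {HX} => [|k] /=.
    field.
    by rewrite xn0.
  rewrite -!exprVn !exprS; set z := x^-1 ^+ k; ring.
- (* [flat k.+1] is the difference quotient of [flat k] at 0. *)
  apply/is_derive1_caratheodory; exists (flat k.+1); split.
  + by move=> z; rewrite subr0 -flatS flat0 subr0.
  + by rewrite /prop_for /continuous_at flat0; exact: flat_cvg0.
  + by rewrite !flat0 mulr0 subr0.
Unshelve. all: by end_near. Qed.

Lemma smooth_flat k : smooth (flat k).
Proof.
rewrite smoothP => n; elim: n k => // n IH k.
exists (flat k.+2 \+ (cst (- k%:R) \* flat k.+1)).
  by move=> x; rewrite /= mulNr; exact: is_derive_flat.
by apply: ndiffD => //; apply: ndiffM => //; exact: ndiff_cst.
Qed.

End Smooth.

(** * Test functions on (0, 1) *)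

Section TestFunctions.
Context {R : realType}.
Implicit Types (f g phi psi : R -> R) (n k : nat) (a b c d x : R).

Definition vanishes_outside c d f := forall x, ~~ (c <= x <= d) -> f x = 0.

(** With [test_functionE], this replaces the condition on the closure of the
    support by two explicit bounds. *)
Lemma test_functionI phi c d : smooth phi -> 0 < c -> d < 1 ->
  vanishes_outside c d phi -> test_function phi.
Proof.
move=> sphi c0 d1 phicd.
have sub : closure [set x | phi x != 0] `<=` `[c, d].
  have /closure_id -> : closed (`[c, d]%classic : set R) by exact:
    interval_closed.
  apply: closureS => x /= phix; rewrite in_itv/=.
  by apply: contraNT phix => /phicd ->.
split=> //.
- by apply: subclosed_compact sub;
  [exact: closed_closure|exact: segment_compact].
- by move=> x /sub /=; rewrite !in_itv/= => /andP[cx xd];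
  rewrite (lt_le_trans c0)// (le_lt_trans xd).
Qed.

Lemma test_functionE phi : test_function phi ->
  exists c d, [/\ 0 < c, c < d, d < 1 & vanishes_outside c d phi].
Proof.
move=> [_ cK KI].
set K := closure _ in cK KI.
have KP x : ~ K x -> phi x = 0.
  by move=> Kx; apply/eqP; apply: contrapT => /negP phix; apply: Kx;
    exact: subset_closure.
have [K0|/set0P Kn0] := eqVneq K set0.
  exists (1/4), (3/4); split; [lra|lra|lra|].
  by move=> x _; apply: KP; rewrite K0.
have [c /set_mem cc cmin] :=
  compact_EVT_min Kn0 cK (@continuous_subspaceT _ _ K id (fun=> cvg_id)).
have [d /set_mem dd dmax] :=
  compact_EVT_max Kn0 cK (@continuous_subspaceT _ _ K id (fun=> cvg_id)).
have := KI _ cc; have := KI _ dd;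
  rewrite /= !in_itv/= => /andP[d0 d1] /andP[c0 c1].
exists (c / 2), ((d + 1) / 2).
have cd : c <= d by apply: cmin; exact: mem_set.
split; [lra|lra|lra|].
move=> x xcd; apply: KP => Kx; move: xcd.
have := cmin _ (mem_set Kx); have := dmax _ (mem_set Kx) => /= xd cx.
by move=> /negP; apply; apply/andP; split; lra.
Qed.

Lemma test_function_smooth phi : test_function phi -> smooth phi.
Proof. by case. Qed.

Lemma test_function_continuous phi : test_function phi -> continuous phi.
Proof. by move=> /test_function_smooth/smooth_continuous. Qed.

Lemma vanishes_outside_derive1 c d f : vanishes_outside c d f ->
  vanishes_outside c d (derive1 f).
Proof.
move=> fcd x xcd; rewrite derive1E.
rewrite (@near_eq_derive _ _ _ _ (cst 0)) ?derive_cst//.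
move: xcd; rewrite negb_and -!ltNge => /orP[xc|dx].
- near=> y; apply: fcd; rewrite negb_and -!ltNge; apply/orP; left.
  by near: y; exact: lt_nbhsl.
- near=> y; apply: fcd; rewrite negb_and -!ltNge; apply/orP; right.
  by near: y; exact: lt_nbhsr.
Unshelve. all: by end_near. Qed.

Lemma test_function_derive1 phi : test_function phi ->
  test_function (derive1 phi).
Proof.
move=> tphi; have [c [d [c0 cd d1 pcd]]] := test_functionE tphi.
apply: (test_functionI _ c0 d1); last exact: vanishes_outside_derive1.
by apply: smooth_derive1; exact: test_function_smooth.
Qed.

Lemma test_functionD phi psi : test_function phi -> test_function psi ->
  test_function (phi \+ psi).
Proof.
move=> tphi tpsi; have [c [d [c0 cd d1 pcd]]] := test_functionE tphi.
have [c' [d' [c0' cd' d1' pcd']]] := test_functionE tpsi.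
apply: (@test_functionI _ (Num.min c c') (Num.max d d')).
- by apply: smoothD; exact: test_function_smooth.
- by rewrite lt_min c0.
- by rewrite gt_max d1.
- move=> x; rewrite negb_and -!ltNge lt_min gt_max => h.
  by rewrite /= pcd ?pcd' ?addr0// negb_and -!ltNge;
    case/orP: h => /andP[h1 h2]; rewrite ?h1 ?h2 ?orbT.
Qed.

Lemma test_functionZ (r : R) phi : test_function phi ->
  test_function (fun x => r * phi x).
Proof.
move=> tphi; have [c [d [c0 cd d1 pcd]]] := test_functionE tphi.
apply: (test_functionI _ c0 d1).
  by apply: (@smoothM _ (cst r));
    [exact: smooth_cst|exact: test_function_smooth].
by move=> x /pcd /= ->; rewrite mulr0.
Qed.

Lemma test_function0 : test_function (cst 0 : R -> R).
Proof.
apply: (@test_functionI _ (1/4) (3/4)); [exact: smooth_cst|lra|lra|by []].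
Qed.

(** Each factor is exp(-1/t) in a variable [t] that grows with [n], so it
    tends to 1 where [t] becomes positive; the shift by 1 keeps the support
    inside the interval, away from its end points. *)
Definition smooth_bump a b n x : R :=
  flat 0 (n.+1%:R * (x - a) - 1) * flat 0 (n.+1%:R * (b - x) - 1).

Lemma flat0_itv x : 0 <= flat 0 x <= 1.
Proof.
rewrite /flat; case: ifPn => [x0|_]; last by rewrite lexx ler01.
rewrite expr0 mul1r expR_ge0 /=.
by rewrite expR_le1 oppr_le0 invr_ge0 ltW.
Qed.

Lemma smooth_bump_itv a b n x : 0 <= smooth_bump a b n x <= 1.
Proof.
have /andP[? ?] := flat0_itv (n.+1%:R * (x - a) - 1).
have /andP[? ?] := flat0_itv (n.+1%:R * (b - x) - 1).
by rewrite /smooth_bump mulr_ge0//= mulr_ile1.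
Qed.

Lemma smooth_bump_vanishes a b n :
  vanishes_outside (a + n.+1%:R^-1) (b - n.+1%:R^-1) (smooth_bump a b n).
Proof.
move=> x; have n0 : 0 < n.+1%:R :> R by rewrite ltr0n.
rewrite negb_and -!ltNge => /orP[xa|bx]; rewrite /smooth_bump.
- rewrite {1}/flat ifF ?mul0r//; apply/negbTE; rewrite -leNgt subr_le0.
  rewrite -ler_pdivlMl// mulr1 lerBlDl; exact: ltW.
- rewrite {2}/flat ifF ?mulr0//; apply/negbTE; rewrite -leNgt subr_le0.
  rewrite -ler_pdivlMl// mulr1 lerBlDl -lerBlDr; exact: ltW.
Qed.

Lemma test_function_smooth_bump a b n : 0 <= a -> b <= 1 ->
  test_function (smooth_bump a b n).
Proof.
move=> a0 b1; have n0 : 0 < n.+1%:R^-1 :> R by rewrite invr_gt0 ltr0n.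
apply: (@test_functionI _ (a + n.+1%:R^-1) (b - n.+1%:R^-1)).
- rewrite (_ : smooth_bump a b n =
    (fun x => flat 0 (n.+1%:R * x + (- (n.+1%:R * a) - 1))) \*
    (fun x => flat 0 (- n.+1%:R * x + (n.+1%:R * b - 1)))); last first.
    by apply/funext => x; rewrite /smooth_bump /=; congr (flat _ _ * flat _ _);
      ring.
  by apply: smoothM; apply: (@smooth_affine _ (flat 0)); exact: smooth_flat.
- by rewrite ltr_pwDr.
- by rewrite ltrBlDr (le_lt_trans b1)// ltrDl.
- exact: smooth_bump_vanishes.
Qed.

Lemma flat0_cvg1 d : 0 < d -> flat 0 (n.+1%:R * d - 1) @[n --> \oo] --> (1 : R).
Proof.
move=> d0.
have uy : (n.+1%:R * d - 1 : R) @[n --> \oo] --> +oo.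
  apply/cvgryPge => A.
  have /cvgryPge/(_ ((A + 1) / d)) := @cvgr_idn R.
  apply: filterS => n; rewrite ler_pdivrMr// => h.
  rewrite lerBrDr (le_trans h)// ler_wpM2r// ?ler_nat//; exact: ltW.
have u0 : (n.+1%:R * d - 1 : R)^-1 @[n --> \oo] --> (0 : R).
  apply/gtr0_cvgV0 => //.
  have /cvgryPgt/(_ 0) := uy; exact.
have : expR (- (n.+1%:R * d - 1 : R)^-1) @[n --> \oo] --> (1 : R).
  rewrite -[X in _ --> X](@expR0 R) -(@oppr0 R).
  exact: (cvg_comp _ _ (cvgN u0) (@continuous_expR R _)).
apply: cvg_trans; apply: near_eq_cvg.
near=> n; rewrite /flat ifT ?expr0 ?mul1r//.
near: n; have /cvgryPgt/(_ 0) := uy; exact.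
Unshelve. all: by end_near. Qed.

(** Together with the uniform bound [smooth_bump_itv], this lets dominated
    convergence pass from test functions to intervals. *)
Lemma smooth_bump_cvg a b x : smooth_bump a b n x @[n --> \oo] --> (\1_(`]a,
  b[%classic) x : R).
Proof.
rewrite indicE; have [xab|xab] := boolP (x \in (`]a, b[%classic : set R)).
  move: xab; rewrite inE/= in_itv/= => /andP[ax xb] /=.
  rewrite -[X in _ --> X](mulr1 1); apply: cvgM; apply: flat0_cvg1;
    by rewrite subr_gt0.
rewrite (_ : (fun n => _) = cst 0); first exact: cvg_cst.
apply/funext => n; apply: smooth_bump_vanishes;
  apply: contra xab => /andP[ax xb].
have n0 : 0 < n.+1%:R^-1 :> R by rewrite invr_gt0 ltr0n.
by rewrite inE/= in_itv/=; move: n0 ax xb; set e := _^-1 => *; apply/andP;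
  split; lra.
Qed.

End TestFunctions.

(** * Real-valued integrable and square-integrable functions *)

Section RealIntegrable.
Context d (T : measurableType d) (R : realType).
Variables (mu : {measure set T -> \bar R}) (D : set T) (mD : measurable D).
Implicit Types f g : T -> R.
Local Notation intg f := (mu.-integrable D (EFin \o f)).

Lemma RintegrableD f g : intg f -> intg g -> intg (fun x => f x + g x).
Proof. by move=> fi gi; exact: (integrableD mD fi gi). Qed.

Lemma RintegrableB f g : intg f -> intg g -> intg (fun x => f x - g x).
Proof. by move=> fi gi; exact: (integrableB mD fi gi). Qed.

Lemma RintegrableZ (r : R) f : intg f -> intg (fun x => r * f x).
Proof. by move=> fi; exact: (integrableZl mD r fi). Qed.

Lemma Rintegrable_measurable f : intg f -> measurable_fun D f.
Proof. by move=> /measurable_int/measurable_EFinP. Qed.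

Lemma le_Rintegrable f g : measurable_fun D f ->
  (forall x, D x -> `|f x| <= g x) -> intg g -> intg f.
Proof.
move=> mf fg; apply: le_integrable => //; first exact/measurable_EFinP.
by move=> x Dx /=; rewrite lee_fin (le_trans (fg _ Dx))// ler_norm.
Qed.

Lemma bounded_Rintegrable f (M : R) : (mu D < +oo)%E -> measurable_fun D f ->
  (forall x, D x -> `|f x| <= M) -> intg f.
Proof.
move=> Doo mf fM; apply: measurable_bounded_integrable => //.
exists M; split; first exact: num_real.
by move=> A MA x /fM /le_trans; apply; exact: ltW.
Qed.

Lemma RintegrableMbounded f g (M : R) : measurable_fun D f ->
  (forall x, D x -> `|f x| <= M) -> intg g -> intg (fun x => f x * g x).
Proof.
move=> mf fM gi; apply: (@le_Rintegrable _ (fun x => M * `|g x|)).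
- by apply: measurable_funM => //; exact: Rintegrable_measurable.
- by move=> x Dx; rewrite normrM ler_wpM2r// fM.
- by apply: RintegrableZ; exact: (integrable_norm gi).
Qed.

Lemma eq_Rintegrable f g : (forall x, D x -> f x = g x) -> intg f -> intg g.
Proof.
move=> fg; apply: eq_integrable => // x; rewrite inE => Dx /=.
by rewrite fg.
Qed.

Lemma ae_eq_Rintegrable f g : measurable_fun D g -> ae_eq mu D f g -> intg f ->
  intg g.
Proof.
move=> mg fg fi; have mf := Rintegrable_measurable fi.
have fgE : ae_eq mu D (EFin \o f) (EFin \o g).
  by apply: filterS fg => x fgx Dx /=; rewrite fgx.
move: fi => /integrableP[mfE foo]; apply/integrableP; split;
  first exact/measurable_EFinP.
rewrite -(ae_eq_integral _ _ _ _ _ (ae_eq_abse fgE))//;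
  apply: measurableT_comp => //.
exact/measurable_EFinP.
Qed.

Lemma ae_eq_Rintegral f g : measurable_fun D f -> measurable_fun D g ->
  ae_eq mu D f g -> \int[mu]_(x in D) f x = \int[mu]_(x in D) g x.
Proof.
move=> mf mg fg; congr fine; apply: ae_eq_integral => //;
  try exact/measurable_EFinP.
by apply: filterS fg => x fgx Dx /=; rewrite fgx.
Qed.

End RealIntegrable.

Section SquareIntegrable.
Context {R : realType}.
Implicit Types (f g : R -> R) (x : R).
Local Notation Lambda := (@lebesgue_measure R).
Local Notation I01 := (`]0, 1[%classic : set R).

Lemma mitv (i : interval R) : @measurable _ (measurableTypeR R) [set` i].
Proof. exact: measurable_itv. Qed.
Hint Resolve mitv : core.

Lemma mI01 : @measurable _ (measurableTypeR R) I01.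
Proof. exact: mitv. Qed.
Hint Resolve mI01 : core.

Lemma RintegrableS (A B : set (measurableTypeR R)) f : measurable A ->
  measurable B ->
  B `<=` A -> Lambda.-integrable A (EFin \o f) ->
    Lambda.-integrable B (EFin \o f).
Proof. exact: integrableS. Qed.

Lemma Lebesgue_I01 : Lambda I01 = 1%E.
Proof. by rewrite lebesgue_measure_itv/= lte01 oppr0 adde0. Qed.

Lemma Lebesgue_I01_lty : (Lambda I01 < +oo)%E.
Proof. by rewrite Lebesgue_I01 ltry. Qed.

(** Square integrability on (0, 1) without extension by zero; [sqintE] relates
    it to [L2]. *)
Definition sqint f := measurable_fun I01 f /\
  Lambda.-integrable I01 (EFin \o (fun x => f x ^+ 2)).

(** The square of the L^2 norm; the factor 2 lost in [sqnormD] is harmless for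
    approximation. *)
Definition sqnorm f := \int[Lambda]_(x in I01) (f x ^+ 2).

Lemma sqnorm_ge0 f : 0 <= sqnorm f.
Proof. by apply: Rintegral_ge0 => x _; exact: sqr_ge0. Qed.

Lemma sqintM f g : sqint f -> sqint g ->
  Lambda.-integrable I01 (EFin \o (fun x => f x * g x)).
Proof.
move=> [mf f2] [mg g2].
apply: (@le_Rintegrable _ _ _ _ _ mI01 _ (fun x => f x ^+ 2 + g x ^+ 2)).
- exact: measurable_funM.
- move=> x _; rewrite normrM -(real_normK (num_real (f x))) -(real_normK
  (num_real (g x))).
  have := normr_ge0 (f x); have := normr_ge0 (g x).
  move: (`|f x|) (`|g x|) => a b b0 a0.
  by have := sqr_ge0 (a - b); nra.
- exact: RintegrableD.
Qed.

Lemma sqint_bounded f (M : R) : measurable_fun I01 f ->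
  (forall x, I01 x -> `|f x| <= M) -> sqint f.
Proof.
move=> mf fM; split => //;
  apply: (@bounded_Rintegrable _ _ _ _ _ mI01 _ (M ^+ 2)).
- exact: Lebesgue_I01_lty.
- exact: measurable_funX.
- by move=> x /fM h; rewrite normrX ler_pXn2r// nnegrE// (le_trans _ h).
Qed.

Lemma sqint_cst (c : R) : sqint (cst c).
Proof. exact: (@sqint_bounded _ `|c|). Qed.

Lemma sqint_Rintegrable f : sqint f -> Lambda.-integrable I01 (EFin \o f).
Proof.
move=> sf; apply: (eq_Rintegrable mI01) (sqintM (sqint_cst 1) sf) => x _ /=.
by rewrite mul1r.
Qed.

Lemma sqintD f g : sqint f -> sqint g -> sqint (f \+ g).
Proof.
move=> sf sg; have [[mf f2] [mg g2]] := (sf, sg).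
split; first exact: measurable_funD.
have := RintegrableD mI01 (RintegrableD mI01 f2 (RintegrableZ mI01 2 (sqintM sf
  sg))) g2.
by apply: eq_Rintegrable => // x _ /=; ring.
Qed.

Lemma sqintZ (r : R) f : sqint f -> sqint (fun x => r * f x).
Proof.
move=> [mf f2]; split; first exact: measurable_funM.
by apply: (eq_Rintegrable mI01) (RintegrableZ mI01 (r ^+ 2) f2) => x _ /=;
  rewrite exprMn.
Qed.

Lemma sqintB f g : sqint f -> sqint g -> sqint (f \- g).
Proof.
move=> sf sg; have [m fg] := sqintD sf (sqintZ (-1) sg).
split; first by apply: measurable_funB; [case: sf|case: sg].
by apply: (eq_Rintegrable mI01) fg => x _ /=; rewrite mulN1r.
Qed.

Lemma sqnormD f g : sqint f -> sqint g ->
  sqnorm (f \+ g) <= 2 * sqnorm f + 2 * sqnorm g.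
Proof.
move=> sf sg; have [[mf f2] [mg g2] [_ fg2]] := And3 sf sg (sqintD sf sg).
rewrite -!RintegralZl// -RintegralD//; [|exact: RintegrableZ..].
apply: le_Rintegral => //; first by apply: RintegrableD => //;
  exact: RintegrableZ.
by move=> x _ /=; have := sqr_ge0 (f x - g x); nra.
Qed.

Lemma sqnormZ (r : R) f : sqint f ->
  sqnorm (fun x => r * f x) = r ^+ 2 * sqnorm f.
Proof.
move=> [_ f2]; rewrite -RintegralZl//.
by apply: eq_Rintegral => x _; rewrite exprMn.
Qed.

Lemma sqnorm_eq f g : (forall x, I01 x -> f x = g x) -> sqnorm f = sqnorm g.
Proof. by move=> fg; apply: eq_Rintegral => x; rewrite inE => /fg ->. Qed.

Lemma sqnorm_aeeq f g : measurable_fun I01 f -> measurable_fun I01 g ->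
  ae_eq Lambda I01 f g -> sqnorm f = sqnorm g.
Proof.
move=> mf mg fg; apply: ae_eq_Rintegral => //; try exact: measurable_funX.
by apply: filterS fg => x fgx Dx; rewrite fgx.
Qed.

Lemma sqint_aeeq f g : measurable_fun I01 g -> ae_eq Lambda I01 f g ->
  sqint f -> sqint g.
Proof.
move=> mg fg [mf f2]; split=> //; apply: ae_eq_Rintegrable f2 => //.
  exact: measurable_funX.
by apply: filterS fg => x fgx Dx; rewrite fgx.
Qed.

Lemma sqnorm_eq0 f : sqint f -> sqnorm f = 0 -> ae_eq Lambda I01 f (cst 0).
Proof.
move=> [mf f2] f0.
have : ae_eq Lambda I01 (EFin \o (fun x => f x ^+ 2)) (cst 0%E).
  apply/(ae_eq_integral_abs _ mI01 (measurable_int _ f2)).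
  under eq_integral do rewrite /= ger0_norm ?sqr_ge0//.
  by rewrite -(fineK (integrable_fin_num mI01 f2)); congr EFin.
by apply: filterS => x h Dx; have /eqP := h Dx; rewrite eqe sqrf_eq0 => /eqP.
Qed.

Lemma le_Rintegral_subset (A B : set (measurableTypeR R)) f : measurable A ->
  measurable B ->
  A `<=` B -> (forall x, B x -> 0 <= f x) -> Lambda.-integrable B (EFin \o f) ->
  \int[Lambda]_(x in A) f x <= \int[Lambda]_(x in B) f x.
Proof.
move=> mA mB AB f0 fi; apply: fine_le.
- exact: (integrable_fin_num mA (integrableS mB mA AB fi)).
- exact: (integrable_fin_num mB fi).
- apply: ge0_subset_integral => //.
  exact: measurable_int fi.
Qed.

(** The Cauchy-Schwarz inequality against the constant 1, on a set of length at
    most 1: expand the integral of [(g - m)^2] with [m] the integral of [g]. *)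
Lemma sqr_Rintegral_le (A : set (measurableTypeR R)) g : measurable A ->
  A `<=` I01 -> sqint g ->
  (\int[Lambda]_(x in A) g x) ^+ 2 <= sqnorm g.
Proof.
move=> mA AI sg; have [mg g2] := sg; set m := \int[Lambda]_(x in A) g x.
have gi := sqint_Rintegrable sg.
have giA : Lambda.-integrable A (EFin \o g) by exact: (integrableS mI01).
have g2A : Lambda.-integrable A (EFin \o (fun x => g x ^+ 2)) by exact:
  (integrableS mI01).
have LA : (Lambda A <= 1)%E by rewrite -Lebesgue_I01; apply: le_measure => //;
  rewrite inE.
have ciA : Lambda.-integrable A (EFin \o cst (m ^+ 2)).
  apply: (@bounded_Rintegrable _ _ _ _ _ mA _ (m ^+ 2)) => //.
    by rewrite (le_lt_trans LA)// ltry.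
  by move=> x _; rewrite /= ger0_norm// sqr_ge0.
have h : 0 <= \int[Lambda]_(x in A) ((g x ^+ 2 - (2 * m) * g x) + cst (m ^+ 2)
  x).
  by apply: Rintegral_ge0 => x _ /=; have := sqr_ge0 (g x - m); nra.
rewrite RintegralD// in h; last by apply: RintegrableB => //;
  exact: RintegrableZ.
rewrite RintegralB// in h; last exact: RintegrableZ.
rewrite RintegralZl// -/m Rintegral_cst// in h.
have : \int[Lambda]_(x in A) (g x ^+ 2) <= sqnorm g.
  by apply: le_Rintegral_subset => // x _; exact: sqr_ge0.
have : 0 <= fine (Lambda A) <= 1.
  rewrite fine_ge0//= -lee_fin fineK// ge0_fin_numE//.
  by rewrite (le_lt_trans LA)// ltry.
have := sqr_ge0 m.
by nra.
Qed.

Lemma Lnorm_sqr f :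
  ('N[Lambda]_2%:E[EFin \o (f \_ I01)] `^ 2 = \int[Lambda]_(x in I01) (f x ^+
    2)%:E)%E.
Proof.
rewrite poweR_Lnorm ?pnatr_eq0// [RHS]integral_mkcond.
apply: eq_integral => x _; rewrite /= !patchE; case: ifPn => _ /=.
  by rewrite powR_mulrn// real_normK ?num_real.
by rewrite normr0 powR_mulrn// expr0n.
Qed.

Lemma sqintE f : sqint f <-> L2 f.
Proof.
have mfE : measurable_fun I01 f <-> measurable_fun [set: R] (f \_ I01).
  exact: measurable_restrictT.
split.
- move=> [mf f2]; rewrite /L2 inE; apply/andP; split; first by rewrite inE;
  apply/mfE.
  rewrite inE /= /finite_norm.
  rewrite lt_neqAle leey andbT; apply/eqP => N.
  have := integrable_fin_num mI01 f2; have := Lnorm_sqr f.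
  by rewrite N poweRyr ?pnatr_eq0// => <-.
- move=> /[dup] Lf /Lfun2_integrable_sqr /= f2.
  move: Lf; rewrite /L2 inE => /andP[]; rewrite inE /= => mf _.
  split; first exact/mfE.
  apply/(integrable_mkcond _ mI01); apply: eq_integrable f2 => // x _ /=.
  by rewrite !patchE; case: ifPn => //=; rewrite expr0n.
Qed.

Lemma L2norm_sqr f : sqint f -> L2norm f ^+ 2 = sqnorm f.
Proof.
move=> [mf f2]; have := integrable_fin_num mI01 f2; have := Lnorm_sqr f.
rewrite /L2norm /sqnorm /Rintegral /=.
case: (Lnorm _ _ _) (Lnorm_ge0 Lambda 2%:E (EFin \o (f \_ I01))) =>
  [r r0 <-||//] _ /=.
- by rewrite powR_mulrn.
- by move=> <-; rewrite pnatr_eq0.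
Qed.

End SquareIntegrable.
#[global] Hint Resolve mitv mI01 : core.

(** * Approximation in the mean *)

Section RealDominated.
Context d (T : measurableType d) (R : realType).
Variables (mu : {measure set T -> \bar R}) (D : set T) (mD : measurable D).

Lemma Rdominated_convergence (f_ : nat -> T -> R) (f g : T -> R) :
  (forall n, measurable_fun D (f_ n)) ->
  (forall x, D x -> f_ n x @[n --> \oo] --> f x) ->
  mu.-integrable D (EFin \o g) ->
  (forall n x, D x -> `|f_ n x| <= g x) ->
  mu.-integrable D (EFin \o f) /\
  \int[mu]_(x in D) f_ n x @[n --> \oo] --> \int[mu]_(x in D) f x.
Proof.
move=> mf_ ff gi fg.
have mf : measurable_fun D f by exact: measurable_fun_cvg ff.
have [||||| fi _ cv] := @dominated_convergence _ _ _ mu D mD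
  (fun n => EFin \o f_ n) (EFin \o f) (EFin \o g).
- by move=> n; exact/measurable_EFinP.
- exact/measurable_EFinP.
- by apply: aeW => x Dx; apply: cvg_EFin; [exact: nearW|exact: ff].
- exact: gi.
- by apply: aeW => x n Dx; rewrite /= lee_fin fg.
split=> //; apply: fine_cvg.
by rewrite fineK//; exact: integrable_fin_num.
Qed.

End RealDominated.

Section Approximation.
Context {R : realType}.
Implicit Types (f g phi psi : R -> R) (S : set (R -> R)) (a b x : R).
Local Notation Lambda := (@lebesgue_measure R).
Local Notation I01 := (`]0, 1[%classic : set R).

Lemma continuous_measurable f (A : set (measurableTypeR R)) : measurable A ->
  continuous f -> measurable_fun A f.
Proof. by move=> mA /continuous_measurable_fun mf; exact: measurable_funTS. Qed.

Lemma continuous_Rintegrable f a b : continuous f ->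
  Lambda.-integrable `[a, b] (EFin \o f).
Proof.
move=> cf; apply: continuous_compact_integrable; first exact: segment_compact.
exact: continuous_subspaceT.
Qed.

Lemma continuous_sqint f : continuous f -> sqint f.
Proof.
move=> cf; split; first exact: continuous_measurable.
have h : Lambda.-integrable `[0, 1] (EFin \o (fun x => f x ^+ 2)).
  apply: continuous_Rintegrable => x;
    apply: (@continuous_comp _ _ _ f (fun y => y ^+ 2)).
    exact: cf.
  exact: exprn_continuous.
by apply: (RintegrableS _ _ _ h) => //; exact: subset_itv_oo_cc.
Qed.

Lemma test_function_sqint phi : test_function phi -> sqint phi.
Proof. by move=> /test_function_continuous/continuous_sqint. Qed.

(** Membership in the L^2 closure of [S].  It is used for test functions and
    for derivatives of test functions. *)
Definition approximable S g := sqint g /\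
  forall eps, 0 < eps -> exists2 phi, S phi & sqnorm (g \- phi) < eps.

Lemma approximableD S f g : S `<=` sqint ->
  (forall phi psi, S phi -> S psi -> S (phi \+ psi)) ->
  approximable S f -> approximable S g -> approximable S (f \+ g).
Proof.
move=> Ssq SD [sf fS] [sg gS]; split; first exact: sqintD.
move=> e e0; have e40 : 0 < e / 4 by lra.
have [phi Sphi fphi] := fS _ e40.
have [psi Spsi gpsi] := gS _ e40.
exists (phi \+ psi); first exact: SD.
rewrite (@sqnorm_eq _ _ ((f \- phi) \+ (g \- psi))); last by move=> x _ /=;
  ring.
have sphi := Ssq _ Sphi; have spsi := Ssq _ Spsi.
by have := sqnormD (sqintB sf sphi) (sqintB sg spsi); lra.
Qed.

Lemma approximableZ S (r : R) f : S `<=` sqint ->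
  (forall phi, S phi -> S (fun x => r * phi x)) ->
  approximable S f -> approximable S (fun x => r * f x).
Proof.
move=> Ssq SZ [sf fS]; split; first exact: sqintZ.
move=> e e0; have r0 : 0 < r ^+ 2 + 1 by have := sqr_ge0 r; lra.
have [phi Sphi fphi] := fS (e / (r ^+ 2 + 1)) ltac:(by rewrite divr_gt0).
exists (fun x => r * phi x); first exact: SZ.
rewrite (@sqnorm_eq _ _ (fun x => r * (f \- phi) x)); last by move=> x _ /=;
  ring.
have sphi := Ssq _ Sphi.
rewrite sqnormZ; last exact: sqintB.
move: fphi; rewrite ltr_pdivlMr// => h; apply: le_lt_trans h.
by have := sqnorm_ge0 (f \- phi); set s := sqnorm _; nra.
Qed.

(** Bounded pointwise convergence on (0, 1) implies convergence in L^2. *)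
Lemma approximable_lim S (g_ : nat -> R -> R) g (M : R) : S `<=` sqint ->
  (forall n, approximable S (g_ n)) ->
  (forall n x, I01 x -> `|g_ n x| <= M) ->
  (forall x, I01 x -> g_ n x @[n --> \oo] --> g x) ->
  approximable S g.
Proof.
move=> Ssq Sg gM gg.
have mg : measurable_fun I01 g.
  by apply: measurable_fun_cvg gg => n; have [[]] := Sg n.
have gM' x : I01 x -> `|g x| <= M.
  move=> Ix; have h : `|g_ n x| @[n --> \oo] --> `|g x| by apply: cvg_norm;
    exact: gg.
  rewrite -(cvg_lim (@Rhausdorff R) h).
  by apply: limr_le; [exact: cvgP h|by apply: nearW => n; exact: gM].
have sg : sqint g by exact: sqint_bounded gM'.
split=> // e e0.
have : sqnorm (g \- g_ n) @[n --> \oo] --> (0 : R).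
  have [|||| _] := @Rdominated_convergence _ _ _ Lambda I01 mI01
    (fun n x => (g x - g_ n x) ^+ 2) (cst 0) (cst ((M + M) ^+ 2)).
  - by move=> n; apply: measurable_funX; apply: measurable_funB => //;
    have [[]] := Sg n.
  - move=> x Ix; have h : g x - g_ n x @[n --> \oo] --> (0 : R).
      by rewrite -(subrr (g x)); apply: cvgB; [exact: cvg_cst|exact: gg].
    by have := cvg_comp _ _ h (@exprn_continuous R 2 _); rewrite expr0n.
  - apply: (@bounded_Rintegrable _ _ _ _ _ mI01 _ ((M + M) ^+ 2)) => //;
    first exact: Lebesgue_I01_lty.
    by move=> x _ /=; rewrite ger0_norm// sqr_ge0.
  - move=> n x Ix /=; have h : `|g x - g_ n x| <= M + M.
      by rewrite (le_trans (ler_normB _ _))// lerD ?gM ?gM'.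
    by rewrite normrX lerXn2r// nnegrE (le_trans _ h).
  by rewrite Rintegral_cst// mul0r.
move=> /cvgrPdist_lt/(_ (e / 4)) h.
have [n hn] : exists n, sqnorm (g \- g_ n) < e / 4.
  have [N _ /(_ N (leqnn _))] := h ltac:(lra).
  by rewrite sub0r normrN ger0_norm ?sqnorm_ge0// => ?; exists N.
have [sgn /(_ (e / 4) ltac:(lra))[phi Sphi hphi]] := Sg n.
exists phi => //.
rewrite (@sqnorm_eq _ _ ((g \- g_ n) \+ (g_ n \- phi))); last by move=> x _ /=;
  ring.
by have := sqnormD (sqintB sg sgn) (sqintB sgn (Ssq _ Sphi)); lra.
Qed.

Lemma approximable_test phi : test_function phi ->
  approximable test_function phi.
Proof.
move=> tphi; split; first exact: test_function_sqint.
move=> e e0; exists phi => //; rewrite (@sqnorm_eq _ _ (cst 0)).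
  by rewrite /sqnorm /= expr0n Rintegral_cst//= mul0r.
by move=> x _ /=; rewrite subrr.
Qed.

Lemma approximable_indic a b : 0 <= a -> b <= 1 ->
  approximable test_function \1_(`]a, b[%classic).
Proof.
move=> a0 b1.
apply: (@approximable_lim test_function (smooth_bump a b) (\1_(`]a, b[%classic)
  : R -> R) 1).
- exact: test_function_sqint.
- by move=> n; apply: approximable_test; exact: test_function_smooth_bump.
- by move=> n x _; have /andP[? ?] := smooth_bump_itv a b n x;
  rewrite ger0_norm.
- by move=> x _; exact: smooth_bump_cvg.
Qed.

End Approximation.

(** * Primitives of test functions *)

Section Primitive.
Context {R : realType}.
Implicit Types (f g h phi psi : R -> R) (a b x : R).
Local Notation Lambda := (@lebesgue_measure R).
Local Notation I01 := (`]0, 1[%classic : set R).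

Definition primitive g x : R := \int[Lambda]_(y in `]0, x[) g y.

Lemma test_function_primitive phi x : test_function phi ->
  primitive (derive1 phi) x = phi x.
Proof.
move=> tphi; have sphi := test_function_smooth tphi.
have [c [d [c0 cd d1 pcd]]] := test_functionE tphi.
have [x0|x0] := leP x 0.
  rewrite /primitive set_itv_ge ?Rintegral_set0 -?leNgt ?bnd_simp//.
  by rewrite pcd// negb_and -!ltNge (le_lt_trans x0).
have cphi' := test_function_continuous (test_function_derive1 tphi).
have ci := continuous_Rintegrable 0 x cphi'.
rewrite /primitive Rintegral_itv_obnd_cbnd; last first.
  by apply: (RintegrableS _ _ _ ci) => //; exact: subset_itv_oo_cc.
rewrite Rintegral_itv_bndo_bndc; last first.
  by apply: (RintegrableS _ _ _ ci) => //; apply: subset_itvl; rewrite bnd_simp.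
rewrite /Rintegral (@continuous_FTC2 _ _ phi)//.
- by rewrite -EFinB /= (pcd 0) ?subr0// negb_and -!ltNge c0.
- exact: continuous_subspaceT.
- have cphi := test_function_continuous tphi; split.
  + by move=> y _; exact: (sphi 0%N).
  + by apply: cvg_at_right_filter; exact: cphi.
  + by apply: cvg_at_left_filter; exact: cphi.
Qed.

Lemma Rintegral_vanishes f c d (A B : set (measurableTypeR R)) :
  vanishes_outside c d f -> `[c, d] `<=` A -> `[c, d] `<=` B ->
  \int[Lambda]_(x in A) f x = \int[Lambda]_(x in B) f x.
Proof.
move=> fcd cdA cdB; rewrite Rintegral_mkcond [RHS]Rintegral_mkcond.
apply: eq_Rintegral => x _; rewrite !patchE.
have [xcd|/fcd ->] := boolP (c <= x <= d); last by do 2 case: ifP.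
by rewrite !mem_set//; [apply: cdB|apply: cdA]; rewrite /= in_itv.
Qed.

Lemma test_function_RintegrableT phi : test_function phi ->
  Lambda.-integrable [set: R] (EFin \o phi).
Proof.
move=> tphi; have [c [d [c0 cd d1 pcd]]] := test_functionE tphi.
have ci := continuous_Rintegrable c d (test_function_continuous tphi).
move: ci => /(integrable_mkcond _ (mitv _)).
apply: eq_integrable => // x _; rewrite patchE; case: ifPn => //.
by rewrite notin_setE/= in_itv/= => /negP/pcd ->.
Qed.

(** The primitive of [h] from minus infinity vanishes to the left of the support
    of [h], and to the right of it because [h] has mean zero. *)
Lemma test_function_antiderivative h : test_function h ->
  \int[Lambda]_(x in I01) h x = 0 ->
  exists2 phi, test_function phi & derive1 phi = h.
Proof.
move=> th h0; have [c [d [c0 cd d1 hcd]]] := test_functionE th.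
have hT := test_function_RintegrableT th.
have ch := test_function_continuous th.
pose F x := \int[Lambda]_(t in `]-oo, x]) h t.
have dF x : is_derive x (1 : R) F (h x).
  have [||||dFx F'x] := @continuous_FTC1 R h -oo%O x (x + 1).
  - by rewrite ltrDl.
  - by apply: (RintegrableS _ _ _ hT).
  - by rewrite ltNyr.
  - exact: ch.
  by rewrite -F'x derive1E; exact: DeriveDef.
exists F; last exact: is_derive_derive1.
apply: (test_functionI _ c0 d1).
  by apply: smooth_primitive dF _; exact: test_function_smooth.
move=> x; rewrite negb_and -!ltNge => /orP[xc|dx].
- rewrite /F (@eq_Rintegral _ _ _ _ _ (cst 0)) ?Rintegral_cst ?mul0r//.
  move=> y; rewrite inE/= in_itv/= => yx; rewrite hcd//.
  by rewrite negb_and -ltNge (le_lt_trans yx).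
- rewrite /F (Rintegral_vanishes hcd (B := I01)) ?h0//.
  + by move=> y /=; rewrite !in_itv/= => /andP[_ yd];
    rewrite (le_trans yd)// ltW.
  + move=> y /=; rewrite !in_itv/= => /andP[cy yd].
    by rewrite (lt_le_trans c0)// (le_lt_trans yd).
Qed.

Definition test_derivative : set (R -> R) :=
  [set derive1 phi | phi in test_function].

Lemma test_derivative_test g : test_derivative g -> test_function g.
Proof. by move=> [phi tphi <-]; exact: test_function_derive1. Qed.

(** A test function that is L^2 close to the indicator of (0, 1) has an integral
    close to 1, which can be normalised. *)
Lemma exists_test_Rintegral1 : exists2 phi : R -> R,
  test_function phi & \int[Lambda]_(x in I01) phi x = 1.
Proof.
have [sI H] := approximable_indic (lexx (0 : R)) (lexx (1 : R)).
have [phi tphi hphi] := H (1/4) ltac:(lra).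
have sphi := test_function_sqint tphi.
have := sqr_Rintegral_le mI01 (fun _ => id) (sqintB sI sphi).
rewrite RintegralB//; [|exact: sqint_Rintegrable..].
have -> : \int[Lambda]_(x in I01) \1_(I01) x = 1 :> R.
  rewrite (@eq_Rintegral _ _ _ _ _ (cst 1)); last by move=> x xI;
    rewrite indicE xI.
  by rewrite Rintegral_cst// mul1r; exact: (congr1 fine (@Lebesgue_I01 R)).
set m := \int[Lambda]_(x in I01) phi x => hm.
have m0 : m != 0.
  by apply/eqP => m0; move: hm;
    rewrite m0 subr0 expr1n leNgt (lt_trans hphi)//; lra.
exists (fun x => m^-1 * phi x); first exact: test_functionZ.
by rewrite RintegralZl ?mulVf//; exact: sqint_Rintegrable.
Qed.

(** An approximating test function has small mean, because [g] has mean zero;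
    subtracting a small multiple of a fixed test function makes the mean
    vanish, and the result is the derivative of a test function. *)
Lemma approximable_mean0 g : approximable test_function g ->
  \int[Lambda]_(x in I01) g x = 0 -> approximable test_derivative g.
Proof.
move=> [sg H] g0; split=> // e e0.
have [b tb b1] := exists_test_Rintegral1.
have sb := test_function_sqint tb.
have k0 : 0 < 2 + 2 * sqnorm b by have := sqnorm_ge0 b; lra.
have [phi tphi hphi] := H (e / (2 + 2 * sqnorm b)) ltac:(by rewrite divr_gt0).
have sphi := test_function_sqint tphi.
set m := \int[Lambda]_(x in I01) phi x.
have tb' := test_functionZ (- m) tb.
have sb' := test_function_sqint tb'.
have th := test_functionD tphi tb'.
have [|psi tpsi psih] := test_function_antiderivative th.
  rewrite RintegralD//; [|exact: sqint_Rintegrable..].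
  by rewrite RintegralZl ?b1 ?mulr1 ?subrr//; exact: sqint_Rintegrable.
exists (derive1 psi); first by exists psi.
rewrite psih (@sqnorm_eq _ _ ((g \- phi) \+ (fun x => m * b x))); last first.
  by move=> x _ /=; ring.
apply: (le_lt_trans (sqnormD (sqintB sg sphi) (sqintZ m sb))).
rewrite sqnormZ//.
have : m ^+ 2 <= sqnorm (g \- phi).
  have := sqr_Rintegral_le mI01 (fun _ => id) (sqintB sg sphi).
  rewrite RintegralB//; [|exact: sqint_Rintegrable..].
  by rewrite g0 sub0r sqrrN.
move: hphi; rewrite ltr_pdivlMr//.
by have := sqnorm_ge0 b; nra.
Qed.

End Primitive.

(** * The fundamental lemma of the calculus of variations *)

Section Fundamental.
Context {R : realType}.
Implicit Types (f g h phi psi : R -> R) (a b x : R).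
Local Notation Lambda := (@lebesgue_measure R).
Local Notation I01 := (`]0, 1[%classic : set R).

Lemma locally_integrable_itv g a b : locally_integrable I01 g -> 0 < a ->
  b < 1 ->
  Lambda.-integrable `[a, b] (EFin \o g).
Proof.
move=> [mg _ gK] a0 b1.
have sub : `[a, b] `<=` I01.
  move=> x /=; rewrite !in_itv/= => /andP[ax xb].
  by rewrite (lt_le_trans a0)// (le_lt_trans xb).
apply/integrableP; split.
  by apply/measurable_EFinP; apply: measurable_funS mg.
exact: gK (@segment_compact _ _ _).
Qed.

(** The bumps of the interval tend boundedly to its indicator. *)
Lemma test_orthogonal_Rintegral0 g a b : locally_integrable I01 g -> 0 < a ->
  b < 1 ->
  (forall phi, test_function phi ->
    \int[Lambda]_(x in I01) (g x * phi x) = 0) ->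
  \int[Lambda]_(x in `]a, b[) g x = 0.
Proof.
move=> lg a0 b1 g0; have gi := locally_integrable_itv lg a0 b1.
have mg := Rintegrable_measurable gi.
have [|||| _] := @Rdominated_convergence _ _ _ Lambda `[a, b] (mitv _)
    (fun n x => g x * smooth_bump a b n x) (fun x => g x * \1_(`]a, b[%classic)
      x)
    (fun x => `|g x|).
- move=> n; apply: measurable_funM => //; apply: continuous_measurable => //.
  by apply: test_function_continuous; apply: test_function_smooth_bump;
    exact: ltW.
- by move=> x _; apply: cvgMr; exact: smooth_bump_cvg.
- exact: (integrable_norm gi).
- move=> n x _; have /andP[? ?] := smooth_bump_itv a b n x.
  by rewrite normrM ler_piMr// ger0_norm.
rewrite (_ : (fun n => _) = cst 0); last first.
  apply/funext => n /=.
  have n0 : 0 < n.+1%:R^-1 :> R by rewrite invr_gt0 ltr0n.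
  rewrite -[RHS](g0 _ (test_function_smooth_bump n (ltW a0) (ltW b1))).
  apply: (@Rintegral_vanishes _ _ (a + n.+1%:R^-1) (b - n.+1%:R^-1)).
  - by move=> x /smooth_bump_vanishes ->; rewrite mulr0.
  - move: n0; set e := _^-1 => e0 x /=; rewrite !in_itv/= => /andP[? ?].
    by apply/andP; split; lra.
  - move: n0; set e := _^-1 => e0 x /=; rewrite !in_itv/= => /andP[? ?].
    by apply/andP; split; lra.
move=> /(cvg_lim (@Rhausdorff R)); rewrite lim_cst; last exact: Rhausdorff.
move=> ->; rewrite Rintegral_mkcond [RHS]Rintegral_mkcond.
apply: eq_Rintegral => x _; rewrite !patchE indicE.
case: ifPn => [|xab]; last by rewrite mulr0 if_same.
rewrite mulr1 => xab; rewrite mem_set//.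
by move: xab; rewrite inE; exact: subset_itv_oo_cc.
Qed.

(** All integrals of [g] over subintervals vanish, and by Lebesgue
    differentiation [g] is almost everywhere the derivative of such an
    integral. *)
Lemma test_orthogonal_ae0 g : locally_integrable I01 g ->
  (forall phi, test_function phi ->
    \int[Lambda]_(x in I01) (g x * phi x) = 0) ->
  ae_eq Lambda I01 g (cst 0).
Proof.
move=> lg g0.
(* These intervals exhaust (0, 1) and have compact closure in it, where [g]
   is integrable. *)
have key n : ae_eq Lambda (`]n.+3%:R^-1, 1 - n.+3%:R^-1[%classic : set R) g
  (cst 0).
  set a := n.+3%:R^-1; set b := 1 - a.
  have a0 : 0 < a by rewrite invr_gt0 ltr0n.
  have b1 : b < 1 by rewrite /b; lra.
  have gi := locally_integrable_itv lg a0 b1.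
  pose f := g \_ `[a, b].
  have fi : Lambda.-integrable [set: R] (EFin \o f).
    by move: gi => /(integrable_mkcond _ (mitv _)); rewrite restrict_EFin.
  have lf : locally_integrable [set: R] f by exact: integrable_locally.
  have := @FTC1 R f (BRight a) (fun y => RintegrableS (@measurableT _ _) (mitv
    _) (@subsetT _ _) fi) lf.
  apply: filterS; first exact: (ae_filter_ringOfSetsType Lambda).
  move=> x /= H; rewrite in_itv/= => /andP[ax xb].
  have [_] := H ltac:(by rewrite lte_fin).
  have -> : f x = g x by rewrite /f patchE mem_set//= in_itv/= !ltW.
  move=> <-; rewrite derive1E (@near_eq_derive _ _ _ _ (cst 0)) ?derive_cst//.
  near=> y.
  have ay : a < y by near: y; exact: lt_nbhsr.
  have yb : y < b by near: y; exact: lt_nbhsl.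
  have yi : Lambda.-integrable `]a, y] (EFin \o f).
    exact: (RintegrableS (@measurableT _ _) (mitv _) (@subsetT _ _) fi).
  rewrite -Rintegral_itv_bndo_bndc; last first.
    by apply: (RintegrableS (mitv _) (mitv _) _ yi); apply: subset_itvl;
      rewrite bnd_simp.
  rewrite -[RHS](test_orthogonal_Rintegral0 lg a0 (lt_trans yb b1) g0).
  apply: eq_Rintegral => z; rewrite inE/= in_itv/= => /andP[az zy].
  by rewrite /f patchE mem_set//= in_itv/= (ltW az)/= ltW// (lt_trans zy).
have := ae_foralln key.
apply: filterS => x H /=; rewrite in_itv/= => /andP[x0 x1].
have m0 : 0 < Num.min x (1 - x) by rewrite lt_min x0 subr_gt0.
have [n] : exists n, n.+3%:R^-1 < Num.min x (1 - x).
  exists (Num.truncn (Num.min x (1 - x))^-1).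
  rewrite -[ltRHS]invrK ltf_pV2 ?posrE ?ltr0n ?invr_gt0//.
  by rewrite (lt_le_trans (truncnS_gt _))// ler_nat ltnS -addn2 leq_addr.
rewrite lt_min => /andP[nx nx1]; apply: (H n).
by rewrite /= in_itv/= nx/= ltrBrDl -ltrBrDr.
Unshelve. all: by end_near. Qed.

End Fundamental.

(** * Fubini on the triangle *)

Section Fubini.
Context {R : realType}.
Local Notation Lambda := (@lebesgue_measure R).
Local Notation I01 := (`]0, 1[%classic : set R).
Variable mu : {sigma_finite_measure set (measurableTypeR R) -> \bar R}.
Variables a b : R -> R.
Hypotheses (ia : mu.-integrable I01 (EFin \o a))
           (ib : Lambda.-integrable I01 (EFin \o b)).

Let A := a \_ I01.
Let B := b \_ I01.
Let f (z : R * R) : R := B z.1 * A z.2 * ((z.2 < z.1)%R : bool)%:R.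

Let mA : measurable_fun [set: measurableTypeR R] A.
Proof. by apply/(measurable_restrictT _ mI01);
  exact: Rintegrable_measurable ia. Qed.

Let mB : measurable_fun [set: measurableTypeR R] B.
Proof. by apply/(measurable_restrictT _ mI01);
  exact: Rintegrable_measurable ib. Qed.

Let mBA : measurable_fun [set: measurableTypeR R * measurableTypeR R]
  (fun z : R * R => B z.1 * A z.2).
Proof.
apply: measurable_funM.
- exact: (measurableT_comp mB (@measurable_fst _ _ _ _)).
- exact: (measurableT_comp mA (@measurable_snd _ _ _ _)).
Qed.

Let mf : measurable_fun [set: measurableTypeR R * measurableTypeR R] f.
Proof.
apply: measurable_funM => //.
apply: (measurableT_comp (f := fun c : bool => c%:R : R)) => //.
by apply: measurable_fun_ltr; [exact: measurable_snd|exact: measurable_fst].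
Qed.

Let iA : mu.-integrable setT (EFin \o A).
Proof. by rewrite -restrict_EFin; apply/(integrable_mkcond _ mI01). Qed.

Let iB : Lambda.-integrable setT (EFin \o B).
Proof. by rewrite -restrict_EFin; apply/(integrable_mkcond _ mI01). Qed.

Let iBA : (Lambda \x mu)%E.-integrable setT (EFin \o (fun z : R * R => B z.1 *
  A z.2)).
Proof.
have mE : measurable_fun setT (EFin \o (fun z : measurableTypeR R *
  measurableTypeR R => B z.1 * A z.2)).
  exact/measurable_EFinP.
apply/(integrable12ltyP _ _ mE).
have [mA' Aoo] := integrableP _ _ _ iA.
have [mB' Boo] := integrableP _ _ _ iB.
pose c := (\int[mu]_y `|(EFin \o A) y|)%E.
have c0 : (0 <= c)%E by exact: integral_ge0.
have cfin : c \is a fin_num by rewrite ge0_fin_numE.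
apply: (@le_lt_trans _ _ (\int[Lambda]_x (`|(EFin \o B) x| * c))%E).
  rewrite le_eqVlt; apply/orP; left; apply/eqP; apply: eq_integral => x _.
  rewrite -ge0_integralZl//; last by apply: (measurableT_comp _ mA');
    exact: abse_measurable.
  by apply: eq_integral => y _; rewrite /= normrM EFinM.
rewrite ge0_integralZr//; last by apply: (measurableT_comp _ mB');
  exact: abse_measurable.
by rewrite muleC lte_mul_pinfty.
Qed.

Let fi : (Lambda \x mu)%E.-integrable setT (EFin \o f).
Proof.
apply: (le_Rintegrable measurableT mf _ (integrable_norm iBA)) => z _ /=.
rewrite /f normrM ler_piMr//.
by case: (_ < _); rewrite ?normr1 ?normr0.
Qed.

(** Both sides integrate [b x * a y] over the triangle [0 < y < x < 1].  With
    the Lebesgue measure this is integration by parts, and with [nu] it is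
    the Green formula. *)
Lemma Fubini_triangle :
  \int[Lambda]_(x in I01) (b x * \int[mu]_(y in `]0, x[) a y) =
  \int[mu]_(y in I01) (a y * \int[Lambda]_(x in `]y, 1[) b x).
Proof.
have L x : (\int[mu]_y (f (x, y))%:E)%E =
    ((fun x => b x * \int[mu]_(y in `]0, x[) a y) \_ I01 x)%:E.
  rewrite patchE; case: ifPn => [xI|/negPf xI]; last first.
    by apply: integral0_eq => y _; rewrite /f /B /= patchE xI !mul0r.
  have sub : `]0, x[ `<=` I01.
    move: xI; rewrite inE/= in_itv/= => /andP[_ x1] y /=;
      rewrite !in_itv/= => /andP[-> yx] /=.
    exact: lt_trans x1.
  have iax := integrableS mI01 (mitv _) sub ia.
  transitivity (\int[mu]_y ((b x)%:E * ((EFin \o a) \_ (`]0%R, x[%classic : set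
    R) y)))%E.
    apply: eq_integral => y _; rewrite restrict_EFin /= -EFinM; congr EFin.
    rewrite /f /B /A /= !patchE xI -mulrA; congr (_ * _).
    move: xI; rewrite inE/= in_itv/= => /andP[x0 x1].
    have [yx|yx] := ltP y x; last first.
      by rewrite mulr0 ifF//; apply/negP => /set_mem /=;
        rewrite in_itv/= => /andP[_]; rewrite ltNge yx.
    rewrite mulr1; congr (if _ then _ else _).
    apply/idP/idP; rewrite !inE/= !in_itv/= ?yx => /andP[-> _] //=.
    exact: lt_trans x1.
  rewrite integralZl//; last exact/(integrable_mkcond _ (mitv _)).
  rewrite -integral_mkcond EFinM; congr (_ * _)%E.
  by rewrite /Rintegral fineK//; exact: (integrable_fin_num (mitv _) iax).
have Rr y : (\int[Lambda]_x (f (x, y))%:E)%E =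
    ((fun y => a y * \int[Lambda]_(x in `]y, 1[) b x) \_ I01 y)%:E.
  rewrite patchE; case: ifPn => [yI|/negPf yI]; last first.
    by apply: integral0_eq => x _; rewrite /f /A /= patchE yI !(mulr0, mul0r).
  have sub : `]y, 1[ `<=` I01.
    move: yI; rewrite inE/= in_itv/= => /andP[y0 _] x /=;
      rewrite !in_itv/= => /andP[yx ->].
    by rewrite (lt_trans y0).
  have iby := RintegrableS mI01 (mitv _) sub ib.
  transitivity (\int[Lambda]_x ((a y)%:E * ((EFin \o b) \_ (`]y, 1%R[%classic :
    set R) x)))%E.
    apply: eq_integral => x _; rewrite restrict_EFin /= -EFinM; congr EFin.
    rewrite /f /B /A /= !patchE yI mulrAC mulrC; congr (_ * _).
    move: yI; rewrite inE/= in_itv/= => /andP[y0 y1].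
    have [yx|yx] := ltP y x; last first.
      by rewrite mulr0 ifF//; apply/negP => /set_mem /=;
        rewrite in_itv/= => /andP[+ _]; rewrite ltNge yx.
    rewrite mulr1; congr (if _ then _ else _).
    apply/idP/idP; rewrite !inE/= !in_itv/= ?yx => /andP[_ ->] //=.
    by rewrite (lt_trans y0).
  rewrite integralZl//; last exact/(integrable_mkcond _ (mitv _)).
  rewrite -integral_mkcond EFinM; congr (_ * _)%E.
  by rewrite /Rintegral fineK//; exact: (integrable_fin_num (mitv _) iby).
have := Fubini fi => /=.
under eq_integral do rewrite L.
under [in RHS]eq_integral do rewrite Rr.
move=> /(congr1 fine) H.
by rewrite Rintegral_mkcond [RHS]Rintegral_mkcond.
Qed.

End Fubini.

(** * Primitives of square-integrable functions *)

Section IsPrimitive.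
Context {R : realType}.
Implicit Types (f g h w phi psi : R -> R) (a b x : R).
Local Notation Lambda := (@lebesgue_measure R).
Local Notation I01 := (`]0, 1[%classic : set R).

Definition is_primitive w g :=
  sqint g /\ forall x, I01 x -> w x = primitive g x.

Lemma subset_itvo0 x : x <= 1 -> `]0, x[ `<=` I01.
Proof.
by move=> x1 y /=; rewrite !in_itv/= => /andP[-> yx] /=; exact: lt_le_trans x1.
Qed.

Lemma sqint_Rintegrable_itvo g x : x <= 1 -> sqint g ->
  Lambda.-integrable `]0, x[ (EFin \o g).
Proof. by move=> x1 /sqint_Rintegrable; apply: RintegrableS => //;
  exact: subset_itvo0. Qed.

Lemma is_primitiveD w g w' g' : is_primitive w g -> is_primitive w' g' ->
  is_primitive (w \+ w') (g \+ g').
Proof.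
move=> [sg wg] [sg' wg']; split; first exact: sqintD.
move=> x /[dup] Ix; rewrite /= in_itv/= => /andP[_ /ltW x1].
rewrite wg// wg'// /primitive RintegralD//; exact: sqint_Rintegrable_itvo.
Qed.

Lemma is_primitiveZ (r : R) w g : is_primitive w g ->
  is_primitive (fun x => r * w x) (fun x => r * g x).
Proof.
move=> [sg wg]; split; first exact: sqintZ.
move=> x /[dup] Ix; rewrite /= in_itv/= => /andP[_ /ltW x1].
rewrite wg// /primitive RintegralZl//; exact: sqint_Rintegrable_itvo.
Qed.

Lemma is_primitiveB w g w' g' : is_primitive w g -> is_primitive w' g' ->
  is_primitive (w \- w') (g \- g').
Proof.
move=> [sg wg] [sg' wg']; split; first exact: sqintB.
move=> x /[dup] Ix; rewrite /= in_itv/= => /andP[_ /ltW x1].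
rewrite wg// wg'// /primitive RintegralB//; exact: sqint_Rintegrable_itvo.
Qed.

Lemma is_primitive_test phi : test_function phi ->
  is_primitive phi (derive1 phi).
Proof.
move=> tphi; split; first exact: test_function_sqint (test_function_derive1
  tphi).
by move=> x _; rewrite test_function_primitive.
Qed.

Lemma is_primitive_le w g x : is_primitive w g -> I01 x -> w x ^+ 2 <= sqnorm g.
Proof.
move=> [sg wg] Ix; rewrite wg//; apply: sqr_Rintegral_le => //.
by apply: subset_itvo0; move: Ix; rewrite /= in_itv/= => /andP[_ /ltW].
Qed.

Lemma test_function_bounded phi : test_function phi ->
  exists M, forall x, `|phi x| <= M.
Proof.
move=> tphi; exists (Num.sqrt (sqnorm (derive1 phi))) => x.
have [|] := pselect (I01 x).
  move=> /(is_primitive_le (is_primitive_test tphi)) h.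
  by rewrite -sqrtr_sqr ler_sqrt ?sqnorm_ge0.
have [c [d [c0 cd d1 pcd]]] := test_functionE tphi.
move=> Ix; rewrite pcd ?normr0 ?sqrtr_ge0//.
apply: contra_notN Ix => /andP[cx xd] /=.
by rewrite in_itv/= (lt_le_trans c0)//= (le_lt_trans xd).
Qed.

Lemma Rintegral_tail g y : Lambda.-integrable I01 (EFin \o g) -> I01 y ->
  \int[Lambda]_(x in `]y, 1[) g x = \int[Lambda]_(x in I01) g x - primitive g y.
Proof.
move=> gi; rewrite /= in_itv/= => /andP[y0 y1].
have gi' : Lambda.-integrable `]0, y[ (EFin \o g).
  by apply: (RintegrableS _ _ _ gi) => //; apply: subset_itvo0; exact: ltW.
rewrite /primitive (Rintegral_itv_bndo_bndc gi').
by rewrite (@Rintegral_itvB _ g (BRight 0) (BLeft 1) y gi)// bnd_simp ltW.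
Qed.

(** Starting the integral at a negative point makes the extension by zero a
    parameterized integral on the whole line, so that continuity at 0 and 1
    needs no separate argument. *)
Lemma is_primitive_extension w g (a y : R) : is_primitive w g -> a < 0 ->
  a < y ->
  \int[Lambda]_(x in I01) g x = 0 -> (forall x, ~ I01 x -> w x = 0) ->
  w y = \int[Lambda]_(x in `[a, y]) ((g \_ I01) x).
Proof.
move=> [sg wg] a0 ay g0 w0.
have gi : Lambda.-integrable [set: R] (EFin \o (g \_ I01)).
  by rewrite -restrict_EFin; apply/(integrable_mkcond _ mI01);
    exact: sqint_Rintegrable.
rewrite -Rintegral_itv_bndo_bndc; last by apply: (RintegrableS _ _ _ gi).
have [y0|y0] := leP y 0.
  rewrite w0; last by rewrite /= in_itv/= ltNge y0.
  rewrite (@eq_Rintegral _ _ _ _ _ (cst 0)) ?Rintegral_cst ?mul0r// => x.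
  rewrite inE/= in_itv/= => /andP[_ xy]; rewrite patchE ifF//.
  by apply/negP => /set_mem/=; rewrite in_itv/= => /andP[];
    rewrite ltNge (le_trans (ltW xy)).
have [y1|y1] := ltP y 1.
  rewrite wg; last by rewrite /= in_itv/= y0.
  rewrite /primitive Rintegral_mkcond [RHS]Rintegral_mkcond.
  apply: eq_Rintegral => x _; rewrite !patchE.
  have [xy|xy] := boolP (x \in (`]0, y[%classic : set R)).
    move: xy; rewrite inE/= in_itv/= => /andP[x0 xy].
    rewrite !mem_set//= in_itv/= ?x0 ?xy ?(lt_trans xy)//.
    by rewrite (le_trans (ltW a0))// ltW.
  case: ifPn => // xay; case: ifPn => // xI.
  move: xy xay xI; rewrite !inE/= !in_itv/= => /negP + /andP[_ xy] /andP[x0 _].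
  by case; rewrite in_setE/= in_itv/= x0.
rewrite w0; last by rewrite /= in_itv/= => /andP[_]; rewrite ltNge y1.
transitivity (\int[Lambda]_(x in I01) g x); first by rewrite g0.
rewrite Rintegral_mkcond [RHS]Rintegral_mkcond.
apply: eq_Rintegral => x _; rewrite !patchE.
have [xI|xI] := boolP (x \in I01); last by rewrite if_same.
rewrite mem_set//; move: xI; rewrite inE/= !in_itv/= => /andP[x0 x1].
by rewrite (lt_le_trans x1)// andbT (le_trans (ltW a0))// ltW.
Qed.

Lemma is_primitive_continuous w g : is_primitive w g ->
  \int[Lambda]_(x in I01) g x = 0 -> (forall x, ~ I01 x -> w x = 0) ->
  continuous w.
Proof.
move=> wg g0 w0 x.
have gi : Lambda.-integrable [set: R] (EFin \o (g \_ I01)).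
  by rewrite -restrict_EFin; apply/(integrable_mkcond _ mI01);
    apply: sqint_Rintegrable; case: wg.
set a := Num.min x 0 - 1; set b := x + 1.
have a0 : a < 0 by rewrite /a ltrBlDr add0r gt_min ltr01 orbT.
have ax : a < x by rewrite /a ltrBlDr gt_min ltrDl ltr01.
have xb : x < b by rewrite /b ltrDl.
have ab : a <= b by rewrite ltW// (lt_trans ax).
have giab : Lambda.-integrable `[a, b] (EFin \o (g \_ I01)) by apply:
  (RintegrableS _ _ _ gi).
have := parameterized_integral_continuous ab giab.
move=> /continuous_within_itvP => /(_ (lt_trans ax xb))[+ _ _].
move=> /(_ x); rewrite in_itv/= ax xb => /(_ isT).
rewrite /continuous_at /parameterized_integral -(is_primitive_extension wg a0
  ax g0 w0).
apply: cvg_trans; apply: near_eq_cvg; near=> y.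
rewrite (is_primitive_extension (a := a) wg)//.
by near: y; exact: lt_nbhsr.
Unshelve. all: by end_near. Qed.

Lemma is_primitive_weak_derivative w g : measurable_fun I01 w ->
  is_primitive w g ->
  weak_derivative w g.
Proof.
move=> mw /[dup] wg [sg wgE].
have gi := sqint_Rintegrable sg.
have wi : Lambda.-integrable I01 (EFin \o w).
  apply: sqint_Rintegrable;
    apply: (@sqint_bounded _ _ (Num.sqrt (sqnorm g))) => // x Ix.
  by rewrite -sqrtr_sqr ler_sqrt ?sqnorm_ge0// (is_primitive_le wg).
split.
- exact: open_integrable_locally.
- exact: open_integrable_locally.
move=> phi tphi.
have tphi' := test_function_derive1 tphi.
have i' := sqint_Rintegrable (test_function_sqint tphi').
transitivity (\int[Lambda]_(x in I01) (derive1 phi x * \int[Lambda]_(y in `]0,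
  x[) g y)).
  by apply: eq_Rintegral => x; rewrite inE => Ix; rewrite wgE// mulrC.
rewrite (Fubini_triangle gi i').
have phi1 : \int[Lambda]_(x in I01) derive1 phi x = 0.
  rewrite -/(primitive _ _) test_function_primitive//.
  have [c [d [c0 cd d1 pcd]]] := test_functionE tphi.
  by rewrite pcd// negb_and -!ltNge d1 orbT.
rewrite -mulN1r -RintegralZl//; last first.
  by apply: sqintM => //; exact: test_function_sqint.
apply: eq_Rintegral => x; rewrite inE => Ix.
by rewrite Rintegral_tail// phi1 test_function_primitive//; ring.
Qed.

End IsPrimitive.

(** * H_0^1 as a space of primitives *)

Section HasSlope.
Context {R : realType}.
Implicit Types (f g h w phi psi : R -> R) (a b x : R).
Local Notation Lambda := (@lebesgue_measure R).
Local Notation I01 := (`]0, 1[%classic : set R).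

Lemma locally_integrable_RintegrableM g phi : locally_integrable I01 g ->
  test_function phi -> Lambda.-integrable I01 (EFin \o (fun x => g x * phi x)).
Proof.
move=> lg tphi; have [c [d [c0 cd d1 pcd]]] := test_functionE tphi.
have gi := locally_integrable_itv lg c0 d1.
have [M phiM] := test_function_bounded tphi.
have : Lambda.-integrable `[c, d] (EFin \o (fun x => phi x * g x)).
  apply: (@RintegrableMbounded _ _ _ _ _ (mitv _) _ _ M) => //.
  by apply: continuous_measurable => //; exact: test_function_continuous.
move=> /(integrable_mkcond _ (mitv _)) h.
apply: (RintegrableS (@measurableT _ _) mI01 (@subsetT _ _)).
apply: eq_integrable h => // x _; rewrite /= patchE; case: ifPn => [_|].
  by rewrite /= mulrC.
by rewrite notin_setE/= in_itv/= => /negP/pcd ->; rewrite mulr0.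
Qed.

(** Two weak derivatives of [f] have the same integral against every test
    function. *)
Lemma weak_derivative_unique f g h : weak_derivative f g ->
  weak_derivative f h ->
  ae_eq Lambda I01 g h.
Proof.
move=> [_ lg fg] [_ lh fh].
have /(_ _) H := @test_orthogonal_ae0 R (g \- h) (locally_integrableB lg lh).
have : ae_eq Lambda I01 (g \- h) (cst 0).
  apply: H => phi tphi.
  under eq_Rintegral do rewrite /= mulrBl.
  rewrite RintegralB//; [|exact: locally_integrable_RintegrableM..].
  by apply/eqP; rewrite subr_eq0 -eqr_opp -fg// -fh.
by apply: filterS => x /= gh /gh /eqP; rewrite subr_eq0 => /eqP.
Qed.

Lemma weak_derivativeB f g f' g' : weak_derivative f g ->
  weak_derivative f' g' ->
  weak_derivative (f \- f') (g \- g').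
Proof.
move=> [lf lg fg] [lf' lg' fg']; split; [exact: locally_integrableB..|].
move=> phi tphi; have tphi' := test_function_derive1 tphi.
under eq_Rintegral do rewrite /= mulrBl.
rewrite RintegralB//; [|exact: locally_integrable_RintegrableM..].
under [in RHS]eq_Rintegral do rewrite /= mulrBl.
rewrite RintegralB//; [|exact: locally_integrable_RintegrableM..].
by rewrite fg// fg'//; ring.
Qed.

Lemma wgradP f g : weak_derivative f g -> weak_derivative f (wgrad f).
Proof. by move=> fg; apply: xgetPex; exists g. Qed.

(** The choice made in [wgrad] is immaterial up to null sets. *)
Lemma wgrad_aeeq f g : weak_derivative f g -> ae_eq Lambda I01 g (wgrad f).
Proof. by move=> fg; exact: (weak_derivative_unique fg (wgradP fg)). Qed.

Lemma wgrad_measurable f g : weak_derivative f g ->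
  measurable_fun I01 (wgrad f).
Proof. by move=> /wgradP[_ [mg _ _] _]. Qed.

Lemma wgrad_sqint f g : weak_derivative f g -> sqint g -> sqint (wgrad f).
Proof.
move=> fg; apply: sqint_aeeq; last exact: wgrad_aeeq.
exact: wgrad_measurable fg.
Qed.

Lemma wgrad_sqnorm f g : weak_derivative f g -> sqint g ->
  sqnorm (wgrad f) = sqnorm g.
Proof.
move=> fg sg; apply/esym/sqnorm_aeeq; [by case: sg|exact: wgrad_measurable fg|].
exact: wgrad_aeeq.
Qed.

Lemma W12norm_sqr f g : sqint f -> sqint g -> weak_derivative f g ->
  W12norm f ^+ 2 = sqnorm f + sqnorm g.
Proof.
move=> sf sg fg; rewrite /W12norm sqr_sqrtr; last by rewrite addr_ge0 ?sqr_ge0.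
by rewrite !L2norm_sqr ?(wgrad_sqnorm fg)//; exact: wgrad_sqint sg.
Qed.

Lemma is_primitive_sqnorm_le w g : sqint w -> is_primitive w g ->
  sqnorm w <= sqnorm g.
Proof.
move=> [mw w2] wg.
apply: (@le_trans _ _ (\int[Lambda]_(x in I01) cst (sqnorm g) x)).
  apply: le_Rintegral => //.
    by apply: sqint_Rintegrable; exact: sqint_cst.
  by move=> x Ix; exact: is_primitive_le.
by rewrite Rintegral_cst// (_ : fine _ = 1) ?mulr1//;
  exact: (congr1 fine (@Lebesgue_I01 R)).
Qed.

(** The working description of H_0^1.  Approximation is required of the
    derivative only: a primitive is controlled in L^2 by its slope
    ([is_primitive_sqnorm_le]).  That [g] has mean zero, hence that [w]
    vanishes continuously at 1, is part of approximability by derivatives of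
    test functions. *)
Definition has_slope w g := [/\ approximable test_derivative g,
  forall x, I01 x -> w x = primitive g x & forall x, ~ I01 x -> w x = 0].

Lemma has_slope_primitive w g : has_slope w g -> is_primitive w g.
Proof. by move=> [[]]. Qed.

Lemma has_slope_sqint w g : has_slope w g -> sqint g.
Proof. by move=> [[]]. Qed.

Lemma test_derivative_mean0 g : test_derivative g ->
  \int[Lambda]_(x in I01) g x = 0.
Proof.
move=> [phi tphi <-]; rewrite -/(primitive _ _) test_function_primitive//.
have [c [d [c0 cd d1 pcd]]] := test_functionE tphi.
by rewrite pcd// negb_and -!ltNge d1 orbT.
Qed.

Lemma test_derivative_sqint : @test_derivative R `<=` sqint.
Proof. by move=> g /test_derivative_test/test_function_sqint. Qed.

(** Derivatives of test functions have mean zero, and the mean is continuous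
    for the L^2 norm. *)
Lemma approximable_derivative_mean0 g : approximable test_derivative g ->
  \int[Lambda]_(x in I01) g x = 0.
Proof.
move=> [sg H]; apply/eqP; rewrite -sqrf_eq0; apply/eqP/le_anti.
rewrite sqr_ge0 andbT; apply/ler_addgt0Pr => e e0; rewrite add0r.
have [phi dphi /ltW hphi] := H _ e0; have sphi := test_derivative_sqint dphi.
apply: le_trans hphi.
have := sqr_Rintegral_le mI01 (fun _ => id) (sqintB sg sphi).
rewrite RintegralB//; [|exact: sqint_Rintegrable..].
by rewrite (test_derivative_mean0 dphi) subr0.
Qed.

Lemma has_slope_mean0 w g : has_slope w g -> \int[Lambda]_(x in I01) g x = 0.
Proof. by move=> [/approximable_derivative_mean0]. Qed.

Lemma has_slope_continuous w g : has_slope w g -> continuous w.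
Proof.
move=> wg; apply: (@is_primitive_continuous _ _ g).
- exact: has_slope_primitive.
- exact: has_slope_mean0 wg.
- by case: wg.
Qed.

Lemma has_slope_weak_derivative w g : has_slope w g -> weak_derivative w g.
Proof.
move=> wg; apply: is_primitive_weak_derivative; last exact: has_slope_primitive.
by apply: continuous_measurable => //; exact: has_slope_continuous wg.
Qed.

Lemma has_slopeD w g w' g' : has_slope w g -> has_slope w' g' ->
  has_slope (w \+ w') (g \+ g').
Proof.
move=> wg wg'; have [_ H] :=
  is_primitiveD (has_slope_primitive wg) (has_slope_primitive wg').
have [[ag _ w0] [ag' _ w0']] := (wg, wg'); split=> //.
- apply: approximableD ag ag'; first exact: test_derivative_sqint.
  move=> _ _ [phi tphi <-] [psi tpsi <-]; exists (phi \+ psi);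
    first exact: test_functionD.
  apply: is_derive_derive1 => x; apply: is_deriveD; apply: smooth_is_derive;
    exact: test_function_smooth.
- by move=> x Ix; rewrite /= w0// w0'// addr0.
Qed.

Lemma has_slopeZ (r : R) w g : has_slope w g ->
  has_slope (fun x => r * w x) (fun x => r * g x).
Proof.
move=> wg; have [_ H] := is_primitiveZ r (has_slope_primitive wg).
have [ag _ w0] := wg; split=> //.
- apply: approximableZ ag; first exact: test_derivative_sqint.
  move=> _ [phi tphi <-]; exists (fun x => r * phi x);
    first exact: test_functionZ.
  apply: is_derive_derive1 => x.
  have := @is_deriveZ _ _ _ phi r x 1 _ (smooth_is_derive x
    (test_function_smooth tphi)).
  by [].
- by move=> x Ix; rewrite w0// mulr0.
Qed.

Lemma has_slope_H01 w g : has_slope w g -> H01 w.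
Proof.
move=> wg; have cw := has_slope_continuous wg.
have wd := has_slope_weak_derivative wg.
have sg := has_slope_sqint wg.
split=> //; first by case: wg.
- split; [by apply/sqintE; exact: continuous_sqint|by exists g|].
  by apply/sqintE; exact: wgrad_sqint sg.
move=> e e0; have [[_ H] _ _] := wg.
have [|_ [phi tphi <-] h] := H (e ^+ 2 / 2);
  first by rewrite divr_gt0// exprn_gt0.
exists phi => //.
have tphi' := test_function_derive1 tphi.
have wgphi := is_primitiveB (has_slope_primitive wg) (is_primitive_test tphi).
have cphi := test_function_continuous tphi.
have cwphi : continuous (w \- phi).
  by move=> x; apply: continuousB; [exact: cw|exact: cphi].
have swphi := continuous_sqint cwphi.
have [sgphi _] := wgphi.
rewrite -(@ltr_pXn2r _ 2)// ?nnegrE ?sqrtr_ge0 ?ltW//.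
rewrite (W12norm_sqr swphi sgphi); last first.
  by apply: is_primitive_weak_derivative => //; exact: continuous_measurable.
by have := is_primitive_sqnorm_le swphi wgphi; lra.
Qed.
Lemma continuous_sqnorm_eq0 f : continuous f -> sqnorm f = 0 ->
  forall x, I01 x -> f x = 0.
Proof.
move=> cf f0 x Ix; apply/eqP; apply: contrapT => /negP fx.
have := sqnorm_eq0 (continuous_sqint cf) f0.
move=> [N [mN N0 sub]].
have : \forall y \near x, ~ (I01 y -> f y = cst 0 y).
  move: Ix; rewrite /= in_itv/= => /andP[x0 x1].
  near=> y => fy.
  have : f y != 0 by near: y; exact: (cvgr_neq0 _ (cf x) fx).
  rewrite fy ?eqxx// in_itv/=; apply/andP; split.
    by near: y; exact: lt_nbhsr.
  by near: y; exact: lt_nbhsl.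
move=> /nbhs_ballP[r /= r0 rN].
have : (Lambda (ball x r) <= Lambda N)%E.
  apply: le_measure; rewrite ?inE//; first exact: measurable_ball.
  by apply: subset_trans sub.
rewrite N0 lebesgue_measure_ball; last exact: ltW.
by rewrite -[X in (_ <= X)%E]/(0%:E) lee_fin leNgt pmulrn_lgt0// r0.
Unshelve. all: by end_near. Qed.

(** If [phi] is close to [w] for the Sobolev norm then it is L^2 close both to
    [w] and to the primitive of the weak derivative of [w], so the two agree
    almost everywhere, and everywhere by continuity. *)
Lemma H01_has_slope w : H01 w -> has_slope w (wgrad w).
Proof.
move=> [cw w0 [/sqintE sw [g wg] /sqintE sg'] H].
have wd := wgradP wg; set g' := wgrad w in sg' wd *.
have approx e : 0 < e -> exists2 phi, test_function phi &
    sqnorm (w \- phi) < e /\ sqnorm (g' \- derive1 phi) < e.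
  move=> e0; have [|phi tphi h] := H (Num.sqrt e); first by rewrite sqrtr_gt0.
  exists phi => //.
  have sphi := test_function_sqint tphi.
  have sphi' := test_function_sqint (test_function_derive1 tphi).
  have dphi : weak_derivative phi (derive1 phi).
    apply: is_primitive_weak_derivative; last exact: is_primitive_test.
    by case: sphi.
  have := W12norm_sqr (sqintB sw sphi) (sqintB sg' sphi') (weak_derivativeB wd
    dphi).
  have : W12norm (w \- phi) ^+ 2 < e.
    by rewrite -[ltRHS](sqr_sqrtr (ltW e0)) ltrXn2r// ?sqrtr_ge0.
  have := sqnorm_ge0 (w \- phi); have := sqnorm_ge0 (g' \- derive1 phi).
  by move=> ? ? ? ?; split; lra.
have ag' : approximable test_derivative g'.
  split=> // e e0; have [phi tphi [_ h]] := approx _ e0.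
  by exists (derive1 phi) => //; exists phi.
(* [W] is the candidate for [w]: the primitive of the weak derivative. *)
pose W x := if x \in I01 then primitive g' x else 0.
have Wg : has_slope W g'.
  by split=> // x; [move=> /mem_set|move=> Ix]; rewrite /W;
    [move=> ->|rewrite memNset].
have cW := has_slope_continuous Wg.
have sW := continuous_sqint cW.
split=> // x Ix.
have : (w \- W) x = 0.
  apply: continuous_sqnorm_eq0 => //.
    by move=> y; apply: continuousB; [exact: cw|exact: cW].
  apply/le_anti; rewrite sqnorm_ge0 andbT; apply/ler_addgt0Pr => e e0;
    rewrite add0r.
  have [|phi tphi [h1 h2]] := approx (e / 4); first by rewrite divr_gt0.
  have sphi := test_function_sqint tphi.
  rewrite (@sqnorm_eq _ _ ((w \- phi) \+ (fun x => -1 * (W \- phi) x)));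
    last by move=> y _ /=; ring.
  have sWphi := sqintB sW sphi.
  have := sqnormD (sqintB sw sphi) (sqintZ (-1) sWphi).
  have -> : sqnorm (fun x => -1 * (W \- phi) x) = sqnorm (W \- phi).
    by rewrite sqnormZ// sqrrN expr1n mul1r.
  have : sqnorm (W \- phi) <= sqnorm (g' \- derive1 phi).
    apply: is_primitive_sqnorm_le => //.
    exact: is_primitiveB (has_slope_primitive Wg) (is_primitive_test tphi).
  by lra.
by move=> /eqP; rewrite subr_eq0 => /eqP ->; rewrite /W mem_set.
Qed.

End HasSlope.

(** * Approximation by step functions *)

Section ApproximableMore.
Context {R : realType}.
Implicit Types (f g : R -> R) (a b x : R).
Local Notation Lambda := (@lebesgue_measure R).
Local Notation I01 := (`]0, 1[%classic : set R).

Lemma eq_approximable (S : set (R -> R)) f g : (forall x, I01 x -> f x = g x) ->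
  approximable S f -> approximable S g.
Proof.
move=> fg [[mf f2] fS]; split.
  split; first by apply: eq_measurable_fun mf => x; rewrite inE; exact: fg.
  by apply: (eq_Rintegrable mI01) f2 => x Ix; rewrite fg.
move=> e /fS[phi Sphi h]; exists phi => //; apply: le_lt_trans h.
by rewrite le_eqVlt; apply/orP; left; apply/eqP/sqnorm_eq => x Ix;
  rewrite /= fg.
Qed.

Local Notation test := (@test_function R).

Lemma approximable_testD f g : approximable test f -> approximable test g ->
  approximable test (f \+ g).
Proof.
by apply: approximableD; [exact: test_function_sqint|exact: test_functionD].
Qed.

Lemma approximable_testZ (r : R) f : approximable test f ->
  approximable test (fun x => r * f x).
Proof.
by apply: approximableZ; [exact: test_function_sqint|move=> phi;
  exact: test_functionZ].
Qed.

Lemma approximable_test_sum n (f : nat -> R -> R) :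
  (forall i, (i < n)%N -> approximable test (f i)) ->
  approximable test (fun x => \sum_(i < n) f i x).
Proof.
elim: n => [_|n IH fT].
  apply: (@eq_approximable _ (cst 0)); first by move=> x _; rewrite big_ord0.
  by apply: approximable_test; exact: test_function0.
apply: (@eq_approximable _ ((fun x => \sum_(i < n) f i x) \+ f n)).
  by move=> x _; rewrite big_ord_recr.
by apply: approximable_testD; [apply: IH => i ni; apply: fT;
  exact: ltnW|exact: fT].
Qed.

Lemma approximable_test_cst (c : R) : approximable test (cst c).
Proof.
apply: (@eq_approximable _ (fun x => c * \1_I01 x)).
  by move=> x Ix; rewrite indicE mem_set// mulr1.
by apply: approximable_testZ; exact: approximable_indic.
Qed.

(** Half-open intervals tile (0, 1) exactly, so that step functions converge at
    every point and not only almost everywhere. *)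
Lemma approximable_indic_co a b : 0 <= a -> b <= 1 ->
  approximable test \1_(`[a, b[%classic).
Proof.
move=> a0 b1.
apply: (@approximable_lim _ test
  (fun n => \1_(`]Num.max (a - n.+1%:R^-1) 0, b[%classic) : R -> R) _ 1).
- exact: test_function_sqint.
- by move=> n; apply: approximable_indic => //; rewrite le_max lexx orbT.
- by move=> n x _; rewrite indicE; case: (_ \in _); rewrite ?normr1 ?normr0.
move=> x; rewrite /= in_itv/= => /andP[x0 x1].
rewrite -[X in _ --> X]/(_ : R).
apply: cvg_near_cst.
have [ax|xa] := leP a x.
  apply: nearW => n; rewrite !indicE; congr (nat_of_bool _)%:R.
  apply/idP/idP; rewrite !inE/= !in_itv/= ?ax => /andP[_ xb] //.
  rewrite xb gt_max x0 !andbT ltrBlDr (le_lt_trans ax)// ltrDl.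
  by rewrite invr_gt0 ltr0n.
have [N _ HN] : \forall n \near \oo, n.+1%:R^-1 < a - x.
  by apply: (cvgr_lt _ cvg_harmonic); rewrite subr_gt0.
exists N => // n /HN /= h.
rewrite !indicE memNset ?memNset//= in_itv/=; apply/negP; rewrite negb_and.
  by rewrite -ltNge xa.
by rewrite -leNgt le_max; apply/orP; left; apply/orP; left;
  rewrite lerBrDr -lerBrDl ltW.
Qed.

End ApproximableMore.

Section MassBelow.
Context {R : realType}.
Variable nu : {finite_measure set (measurableTypeR R) -> \bar R}.
Variables (u : R -> R) (M : R).
Hypotheses (cu : continuous u) (uM : forall x, `|u x| <= M).
Local Notation Lambda := (@lebesgue_measure R).
Local Notation I01 := (`]0, 1[%classic : set R).
Implicit Types x y : R.

(** The distribution function, up to the point [x], of the signed measure with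
    density [u] with respect to [nu]. *)
Definition mass_below x : R := \int[nu]_(y in `]0, x[) u y.

Let K := M * fine (nu I01).

Lemma nu_lty (A : set (measurableTypeR R)) : measurable A -> (nu A < +oo)%E.
Proof. by move=> mA; rewrite -ge0_fin_numE//; exact: fin_num_measure. Qed.

Lemma nu_Rintegrable (i : interval R) : nu.-integrable [set` i] (EFin \o u).
Proof.
apply: (@bounded_Rintegrable _ _ _ _ _ (mitv i) _ M) => //; first exact: nu_lty.
exact: continuous_measurable.
Qed.

Lemma mass_belowE x : x <= 1 ->
  mass_below x = \int[nu]_(y in I01) (u y * \1_(`]0, x[%classic) y).
Proof.
move=> x1; rewrite /mass_below Rintegral_mkcond [RHS]Rintegral_mkcond.
apply: eq_Rintegral => y _; rewrite !patchE indicE.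
case: ifPn => [yx|_]; last by rewrite mulr0 if_same.
by rewrite mulr1 mem_set//; apply: (subset_itvo0 x1); exact/set_mem.
Qed.

(** Left continuity: the open intervals (0, y) exhaust (0, x) as [y] tends to
    [x] from the left. *)
Lemma mass_below_cvg x (y_ : nat -> R) : x <= 1 -> (forall n, y_ n <= x) ->
  y_ n @[n --> \oo] --> x -> mass_below (y_ n) @[n --> \oo] --> mass_below x.
Proof.
move=> x1 yx yc; rewrite mass_belowE//.
under eq_fun do rewrite mass_belowE ?(le_trans (yx _))//.
have [|||| _ //] := @Rdominated_convergence _ _ _ nu I01 mI01
  (fun n z => u z * \1_(`]0, y_ n[%classic) z) (fun z => u z * \1_(`]0,
    x[%classic) z) (cst M).
- move=> n; apply: measurable_funM; first exact: continuous_measurable.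
  exact: measurable_indic.
- move=> z _; apply: cvgMr; apply: cvg_near_cst.
  have [xz|zx] := leP x z.
    apply: nearW => n; rewrite !indicE !memNset//= in_itv/= => /andP[_].
      by rewrite ltNge xz.
    by rewrite ltNge (le_trans (yx n)).
  have : \forall n \near \oo, z < y_ n by exact: (cvgr_gt _ yc).
  apply: filterS => n zy; rewrite !indicE; congr (nat_of_bool _)%:R.
  by apply/idP/idP; rewrite !inE/= !in_itv/= zx zy.
- apply: (@bounded_Rintegrable _ _ _ _ _ mI01 _ `|M|) => //; exact: nu_lty.
- move=> n z _; rewrite indicE normrM.
  by case: (_ \in _); rewrite ?normr1 ?mulr1 ?normr0 ?mulr0//
    (le_trans _ (uM z)).
Qed.

Lemma mass_below_le x : x <= 1 -> `|mass_below x| <= K.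
Proof.
move=> x1; rewrite mass_belowE//.
have mi : measurable_fun I01 (fun y => u y * \1_(`]0, x[%classic) y).
  by apply: measurable_funM;
    [exact: continuous_measurable|exact: measurable_indic].
have le y : `|u y * \1_(`]0, x[%classic) y| <= M.
  rewrite indicE normrM.
  by case: (_ \in _); rewrite ?normr1 ?mulr1 ?normr0 ?mulr0//
    (le_trans _ (uM y)).
have ii := bounded_Rintegrable mI01 (nu_lty mI01) mi (fun y _ => le y).
apply: (le_trans (le_normr_Rintegral mI01 ii)).
rewrite /K -Rintegral_cst//; apply: le_Rintegral => //.
- exact: (integrable_norm ii).
- by apply: (@bounded_Rintegrable _ _ _ _ _ mI01 _ `|M|) => //; exact: nu_lty.
Qed.

(** Sample at the last point of the grid of step [1 / n.+1] that is at most the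
    argument; left continuity gives convergence at every point. *)
Lemma approximable_mass_below : approximable test_function mass_below.
Proof.
pose s n x := \sum_(i < n.+1) mass_below (i%:R / n.+1%:R) *
   \1_(`[i%:R / n.+1%:R, i.+1%:R / n.+1%:R[%classic) x.
pose y n x : R := (Num.truncn (n.+1%:R * x))%:R / n.+1%:R.
have n0 n : 0 < n.+1%:R :> R by rewrite ltr0n.
(* [y n x] is the last grid point of step [1 / n.+1] up to [x]. *)
have yP n x : 0 <= x -> y n x <= x < y n x + n.+1%:R^-1.
  move=> x0; have := truncn_itv (mulr_ge0 (ltW (n0 n)) x0).
  rewrite /y => /andP[h1 h2]; rewrite ler_pdivrMr// [x * _]mulrC h1/=.
  by rewrite -[X in _ + X]mul1r -mulrDl ltr_pdivlMr// [x * _]mulrC natr1.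
have sE n x : I01 x -> s n x = mass_below (y n x).
  rewrite /= in_itv/= => /andP[x0 x1].
  have kn : (Num.truncn (n.+1%:R * x) < n.+1)%N.
    by rewrite truncn_lt_nat ?mulr_ge0 ?ltW// gtr_pMr.
  rewrite /s (bigD1 (Ordinal kn))//= big1 ?addr0.
    rewrite -/(y n x) indicE mem_set ?mulr1//= in_itv/=.
    have /andP[-> /=] := yP n x (ltW x0).
    by rewrite /y -[(Num.truncn _).+1%:R]natr1 mulrDl mul1r.
  move=> i ik; rewrite indicE memNset ?mulr0//= in_itv/= => /andP[h1 h2].
  move/negP: ik; apply; apply/eqP/val_inj => /=; apply/esym/truncn_def.
  by rewrite [_ * x]mulrC -ler_pdivrMr// h1/= -ltr_pdivlMr.
apply: (@approximable_lim _ test_function s mass_below K).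
- exact: test_function_sqint.
- move=> n; apply: (@approximable_test_sum _ n.+1 (fun i x => mass_below (i%:R
  / n.+1%:R) *
    \1_(`[i%:R / n.+1%:R, i.+1%:R / n.+1%:R[%classic) x)) => i ni.
  apply: approximable_testZ.
  apply: approximable_indic_co; first by rewrite divr_ge0.
  by rewrite ler_pdivrMr// mul1r ler_nat.
- move=> n x Ix; rewrite sE//; apply: mass_below_le.
  move: Ix; rewrite /= in_itv/= => /andP[x0 x1].
  by have /andP[h _] := yP n x (ltW x0); rewrite (le_trans h)// ltW.
- move=> x Ix; under eq_fun do rewrite sE//.
  move: Ix; rewrite /= in_itv/= => /andP[x0 x1].
  apply: mass_below_cvg; first exact: ltW.
    by move=> n; have /andP[] := yP n x (ltW x0).
  apply: (@squeeze_cvgr _ _ _ _ (fun n => x - n.+1%:R^-1) (cst x)).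
  + apply: nearW => n /=; have /andP[-> h] := yP n x (ltW x0).
    by rewrite andbT lerBlDr ltW.
  + rewrite -[X in _ --> X](subr0 x); apply: cvgB; first exact: cvg_cst.
    exact: cvg_harmonic.
  + exact: cvg_cst.
Qed.

End MassBelow.

(** * The Green operator *)

Section Green.
Context {R : realType}.
Variable nu : {finite_measure set (measurableTypeR R) -> \bar R}.
Local Notation Lambda := (@lebesgue_measure R).
Local Notation I01 := (`]0, 1[%classic : set R).
Implicit Types (u w f : R -> R) (x y : R).

Lemma H01_bounded u : H01 u -> exists M, forall x, `|u x| <= M.
Proof.
move=> /H01_has_slope uu; have [_ _ u0] := uu.
exists (Num.sqrt (sqnorm (wgrad u))) => x.
have [Ix|Ix] := pselect (I01 x); last by rewrite u0// normr0 sqrtr_ge0.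
by rewrite -sqrtr_sqr ler_sqrt ?sqnorm_ge0//
  (is_primitive_le (has_slope_primitive uu)).
Qed.

Lemma H01_continuous u : H01 u -> continuous u.
Proof. by case. Qed.

(** The first term is the constant that gives the slope mean zero on (0, 1),
    so that the primitive vanishes at 1. *)
Definition green_slope u x : R :=
  \int[Lambda]_(y in I01) mass_below nu u y - mass_below nu u x.

(** The solution of [- v'' = u nu] with [v(0) = v(1) = 0]. *)
Definition green u x : R :=
  if x \in I01 then primitive (green_slope u) x else 0.

Lemma green_has_slope u : H01 u -> has_slope (green u) (green_slope u).
Proof.
move=> Hu; have [M uM] := H01_bounded Hu.
have aU := approximable_mass_below nu (H01_continuous Hu) uM.
have sU := aU.1.
split; last 2 first.
- by move=> x Ix; rewrite /green mem_set.
- by move=> x Ix; rewrite /green memNset.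
apply: approximable_mean0.
  set c := \int[Lambda]_(y in I01) mass_below nu u y.
  apply: (@eq_approximable _ _ ((cst c) \+ (fun x => -1 * mass_below nu u x))).
    by move=> x _; rewrite /= mulN1r.
  by apply: approximable_testD;
    [exact: approximable_test_cst|exact: approximable_testZ].
rewrite /green_slope; set c := \int[Lambda]_(y in I01) mass_below nu u y.
rewrite (@RintegralB _ _ _ _ _ (cst c))//; last 2 first.
- by apply: sqint_Rintegrable; exact: sqint_cst.
- exact: sqint_Rintegrable.
rewrite Rintegral_cst// (_ : fine _ = 1) ?mulr1 ?subrr//.
exact: (congr1 fine (@Lebesgue_I01 R)).
Qed.

Lemma I1E w g w' g' : has_slope w g -> has_slope w' g' ->
  I1 w w' = \int[Lambda]_(x in I01) (g x * g' x).
Proof.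
move=> wg wg'; have [wd wd'] :=
  (has_slope_weak_derivative wg, has_slope_weak_derivative wg').
have [[mg _] [mg' _]] := (has_slope_sqint wg, has_slope_sqint wg').
have mw := wgrad_measurable wd; have mw' := wgrad_measurable wd'.
apply: ae_eq_Rintegral => //; try exact: measurable_funM.
have := wgrad_aeeq wd; have := wgrad_aeeq wd'.
by apply: filterS2 => x h1 h2 Ix; rewrite h1// h2.
Qed.

Lemma has_slope_sqnorm0 w g : has_slope w g -> sqnorm g = 0 -> w = cst 0.
Proof.
move=> wg g0; apply/funext => x /=; have [_ _ w0] := wg.
have [Ix|Ix] := pselect (I01 x); last by rewrite w0.
have := is_primitive_le (has_slope_primitive wg) Ix; rewrite g0 => h.
by apply/eqP; rewrite -sqrf_eq0 eq_le h sqr_ge0.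
Qed.

(** The constant part of the slope of [green u] integrates to zero against the
    slope of [w]; the other part is handled by [Fubini_triangle], the slope of
    [w] having integral [- w y] over (y, 1). *)
Lemma I1_green u w : H01 u -> H01 w -> I1 (green u) w = nu_form nu u w.
Proof.
move=> Hu Hw; have uG := green_has_slope Hu; have wW := H01_has_slope Hw.
rewrite (I1E uG wW); set h := wgrad w in wW *.
have hi := sqint_Rintegrable (has_slope_sqint wW).
have h0 := has_slope_mean0 wW.
have [M uM] := H01_bounded Hu; have cu := H01_continuous Hu.
have sU := (approximable_mass_below nu cu uM).1.
have sh := has_slope_sqint wW.
rewrite /green_slope; set c := \int[Lambda]_(y in I01) mass_below nu u y.
under eq_Rintegral do rewrite mulrBl.
rewrite RintegralB//; [|exact: RintegrableZ|exact: sqintM].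
rewrite RintegralZl// h0 mulr0 sub0r.
under eq_Rintegral do rewrite mulrC.
rewrite (Fubini_triangle (nu_Rintegrable nu cu uM _) hi).
have [M' wM] := H01_bounded Hw; have cw := H01_continuous Hw.
have uwi : nu.-integrable I01 (EFin \o (fun y => u y * w y)).
  apply: (@RintegrableMbounded _ _ _ _ _ mI01 _ _ M) => //.
    exact: continuous_measurable.
  exact: (nu_Rintegrable nu cw wM `]0, 1[).
transitivity (- \int[nu]_(y in I01) (-1 * (u y * w y))); last first.
  by rewrite RintegralZl// mulN1r opprK.
congr (- _); apply: eq_Rintegral => y; rewrite inE => Iy.
rewrite Rintegral_tail// h0 sub0r.
by have [_ -> //] := has_slope_primitive wW; ring.
Qed.

(** The chosen representative is the only one: the difference of two is
    [I1]-orthogonal to itself. *)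
Lemma T_nuE u : H01 u -> T_nu nu u = green u.
Proof.
move=> Hu; have uG := green_has_slope Hu.
apply: xget_unique.
  split; first exact: has_slope_H01 uG.
  by move=> w Hw; rewrite I1_green.
move=> v [Hv vE]; have vV := H01_has_slope Hv.
have dD := has_slopeD vV (has_slopeZ (-1) uG).
set d := _ \+ _ in dD; set g := _ \+ _ in dD.
have Hd := has_slope_H01 dD.
have sd := has_slope_sqint dD.
have : sqnorm g = 0.
  have := vE _ Hd; rewrite -(I1_green Hu Hd) (I1E uG dD) (I1E vV dD) =>
    /esym/eqP.
  rewrite -subr_eq0 -RintegralB//; last 2 first.
  - by apply: sqintM => //; exact: has_slope_sqint vV.
  - by apply: sqintM => //; exact: has_slope_sqint uG.
  move=> /eqP <-; apply: eq_Rintegral => x _; rewrite /g /=; ring.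
move=> /(has_slope_sqnorm0 dD) d0; apply/funext => x.
have := congr1 (fun f => f x) d0; rewrite /d /= => /eqP.
by rewrite mulN1r subr_eq0 => /eqP.
Qed.

End Green.

(** * Constant slope off the support *)

Section Affine.
Context {R : realType}.
Local Notation Lambda := (@lebesgue_measure R).
Local Notation I01 := (`]0, 1[%classic : set R).
Implicit Types (w g : R -> R) (x y k : R).

Lemma has_slope_affine w g x y k : has_slope w g -> 0 <= x -> x <= y ->
  y <= 1 ->
  (forall z, x <= z <= y -> g z = k) -> w y - w x = k * (y - x).
Proof.
move=> wg x0 xy y1 gk; have [_ _ w0] := wg.
have pw := has_slope_primitive wg; have m0 := has_slope_mean0 wg.
have gi : Lambda.-integrable [set: R] (EFin \o (g \_ I01)).
  rewrite -restrict_EFin; apply/(integrable_mkcond _ mI01).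
  exact: sqint_Rintegrable (has_slope_sqint wg).
(* Any negative starting point would do for [is_primitive_extension]. *)
have N10 : -1 < 0 :> R by lra.
rewrite (is_primitive_extension pw N10 _ m0 w0); last by lra.
rewrite (is_primitive_extension pw N10 _ m0 w0 (y := x)); last by lra.
have giy : Lambda.-integrable `[-1, y] (EFin \o (g \_ I01)) by apply:
  (RintegrableS _ _ _ gi).
rewrite (@Rintegral_itvB _ _ (BLeft (-1)) (BRight y) x giy); last 2 first.
- by rewrite bnd_simp; lra.
- by rewrite bnd_simp.
rewrite -Rintegral_itv_bndo_bndc; last by apply: (RintegrableS _ _ _ gi).
transitivity (\int[Lambda]_(z in `]x, y[) cst k z).
  apply: eq_Rintegral => z; rewrite inE/= in_itv/= => /andP[xz zy].
  rewrite patchE mem_set/= ?gk ?(ltW xz) ?(ltW zy)//.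
  by rewrite in_itv/= (le_lt_trans x0)//= (lt_le_trans zy).
rewrite Rintegral_cst//; congr (_ * _).
rewrite [X in fine X](lebesgue_measure_itv `]x, y[) /= lte_fin;
  case: ifPn => //.
rewrite -leNgt => yx; have -> : y = x by apply/le_anti; rewrite yx xy.
by rewrite subrr.
Qed.

End Affine.

Section GreenDomain.
Context {R : realType}.
Variable nu : {finite_measure set (measurableTypeR R) -> \bar R}.
Local Notation Lambda := (@lebesgue_measure R).
Local Notation I01 := (`]0, 1[%classic : set R).
Implicit Types (u w f : R -> R) (x y z : R).

(** The null open sets cover the interval, and finitely many of them suffice
    by compactness. *)
Lemma nu_itv_off_supp z1 z2 : `[z1, z2] `<=` `[0, 1]%classic `\` supp nu ->
  nu `[z1, z2]%classic = 0%E.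
Proof.
move=> off; have := @segment_compact R z1 z2; rewrite compact_cover.
move=> /(_ (set R) [set V | open V /\ nu V = 0%E] id)[||D' D'D cov].
- by move=> V [].
- move=> z /off[z01 zsupp].
  have [V [oV Vz V0]] : exists V : set R, [/\ open V, V z & nu V = 0%E].
    apply: contrapT => noV; apply: zsupp; split; first exact: z01.
    move=> V oV Vz; rewrite lt_neqAle measure_ge0 andbT eq_sym; apply/eqP => V0.
    by apply: noV; exists V.
  by exists V.
apply/(negligibleP _ (mitv _)); apply: (negligibleS (mu := nu) cov).
rewrite /cover bigcup_fset big_seq; apply: big_ind => [|A B|V /D'D].
- exact: negligible_set0.
- exact: negligibleU.
- by rewrite inE => -[oV V0]; apply/negligibleP => //; exact: open_measurable.
Qed.

Lemma mass_below_off_supp u x y : continuous u -> 0 <= x -> x <= y -> y <= 1 ->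
  `[x, y] `<=` `[0, 1]%classic `\` supp nu ->
  mass_below nu u x = mass_below nu u y.
Proof.
move=> cu x0 xy y1 off; rewrite !mass_belowE ?(le_trans xy)//.
have mi z : measurable_fun (I01 : set (measurableTypeR R)) (fun y => u y *
  \1_(`]0, z[%classic) y).
  by apply: measurable_funM;
    [exact: continuous_measurable|exact: measurable_indic].
apply: ae_eq_Rintegral => //.
exists `[x, y]%classic; split=> //; first exact: nu_itv_off_supp.
move=> z /= nz; rewrite in_itv/=; apply: contrapT => /negP.
rewrite negb_and -!ltNge => zxy; apply: nz => _; congr (_ * _).
rewrite !indicE; congr (nat_of_bool _)%:R.
apply/idP/idP; rewrite !inE/= !in_itv/= => /andP[-> h] /=.
  exact: lt_le_trans h xy.
by case/orP: zxy => // yz; move: h; rewrite ltNge (ltW yz).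
Qed.

(** On a component off the support no [nu]-mass is picked up, so the slope of
    [green u] is constant. *)
Lemma green_dom_E u : H01 u -> dom_E nu (green nu u).
Proof.
move=> Hu; have uG := green_has_slope nu Hu; have cu := H01_continuous Hu.
split; first exact: has_slope_H01 uG.
split; first by apply: continuous_subspaceT; exact: has_slope_continuous uG.
move=> x xA; set k := green_slope nu u x.
exists k, (green nu u x - k * x) => y.
set A := _ `\` _ => yC.
have Cint : is_interval (connected_component A x).
  by apply/connected_intervalP; exact: component_connected.
have xC := connected_component_refl xA.
have sub z1 z2 : connected_component A x z1 -> connected_component A x z2 ->
    `[z1, z2] `<=` A.
  move=> h1 h2 z /=; rewrite in_itv/= => zz;
    apply: (@connected_component_sub _ _ x).
  exact: Cint h1 h2 _ zz.
have A01 z : A z -> 0 <= z <= 1 by move=> [/=]; rewrite in_itv.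
have kE z1 z2 : connected_component A x z1 -> connected_component A x z2 ->
  z1 <= z2 ->
    green_slope nu u z1 = green_slope nu u z2.
  move=> h1 h2 z12; rewrite /green_slope (@mass_below_off_supp _ z1 z2)//.
  - by have /connected_component_sub/A01/andP[] := h1.
  - by have /connected_component_sub/A01/andP[] := h2.
  - exact: sub.
have /andP[x0 x1] := A01 _ xA.
have /andP[y0 y1] := A01 _ (connected_component_sub yC).
have [xy|/ltW yx] := leP x y.
- have : green nu u y - green nu u x = k * (y - x).
    apply: (has_slope_affine uG) => // z /andP[xz zy].
    have zC : connected_component A x z by apply: (Cint _ _ xC yC); rewrite xz.
    by rewrite /k (kE x z).
  lra.
- have : green nu u x - green nu u y = k * (x - y).
    apply: (has_slope_affine uG) => // z /andP[yz zx].
    have zC : connected_component A x z by apply: (Cint _ _ yC xC); rewrite yz.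
    by rewrite /k (kE z x).
  lra.
Qed.

Lemma dom_EZ (r : R) f : dom_E nu f -> dom_E nu (fun x => r * f x).
Proof.
move=> [Hf [cf af]]; have ff := H01_has_slope Hf.
have Hrf := has_slope_H01 (has_slopeZ r ff).
split=> //; split.
  by apply: continuous_subspaceT; exact: H01_continuous.
move=> x xA; have [a [b ab]] := af x xA.
by exists (r * a), (r * b) => y yC; rewrite ab//; ring.
Qed.

Lemma dom_ED f f' : dom_E nu f -> dom_E nu f' -> dom_E nu (f \+ f').
Proof.
move=> [Hf [cf af]] [Hf' [cf' af']]; have ff := H01_has_slope Hf;
  have ff' := H01_has_slope Hf'.
have HD := has_slope_H01 (has_slopeD ff ff').
split=> //; split.
  by apply: continuous_subspaceT; exact: H01_continuous.
move=> x xA; have [a [b ab]] := af x xA; have [a' [b' ab']] := af' x xA.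
by exists (a + a'), (b + b') => y yC; rewrite /= ab// ab'//; ring.
Qed.

Lemma nu_form_sym u w : nu_form nu u w = nu_form nu w u.
Proof. by apply: eq_Rintegral => x _; rewrite mulrC. Qed.

Lemma I1_sym w w' : I1 w w' = I1 w' w :> R.
Proof. by apply: eq_Rintegral => x _; rewrite mulrC. Qed.

Lemma I1Zl (r : R) w w' : H01 w -> H01 w' ->
  I1 (fun x => r * w x) w' = r * I1 w w'.
Proof.
move=> /H01_has_slope ww /H01_has_slope ww'.
rewrite (I1E (has_slopeZ r ww) ww') (I1E ww ww') -RintegralZl//.
  by apply: eq_Rintegral => x _; rewrite mulrA.
by apply: sqintM; [exact: has_slope_sqint ww|exact: has_slope_sqint ww'].
Qed.

Lemma I1Dl w1 w2 w' : H01 w1 -> H01 w2 -> H01 w' ->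
  I1 (w1 \+ w2) w' = I1 w1 w' + I1 w2 w'.
Proof.
move=> /H01_has_slope h1 /H01_has_slope h2 /H01_has_slope ww'.
rewrite (I1E (has_slopeD h1 h2) ww') (I1E h1 ww') (I1E h2 ww') -RintegralD//.
- by apply: eq_Rintegral => x _; rewrite mulrDl.
- by apply: sqintM; [exact: has_slope_sqint h1|exact: has_slope_sqint ww'].
- by apply: sqintM; [exact: has_slope_sqint h2|exact: has_slope_sqint ww'].
Qed.

Lemma I1_definite w : H01 w -> I1 w w = 0 -> w = cst 0.
Proof.
move=> /H01_has_slope ww; rewrite (I1E ww ww) => w0.
by apply: (has_slope_sqnorm0 ww); rewrite -w0; apply: eq_Rintegral => x _;
  rewrite expr2.
Qed.

End GreenDomain.

Theorem proposition4p10 (R : realType)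
    (nu : {finite_measure set (measurableTypeR R) -> \bar R})
    (nu_on01 : nu (~` `]0, 1[%classic) = 0%E)
    (nu_neq0 : nu `]0, 1[%classic <> 0%E)
    (lambda : R) (lambda_gt0 : 0 < lambda) :
  H01_eigenvalue (T_nu nu) lambda <-> krein_feller_eigenvalue nu (lambda^-1).
Proof.
have l0 : lambda != 0 by rewrite gt_eqF.
split=> [[phi [Hphi phi0 Tphi]]|[u [[Hu Cu] u0 uE]]].
- have Gphi : phi = (fun x => lambda^-1 * green nu phi x).
    by apply/funext => x; rewrite -T_nuE// Tphi mulKf.
  have dG := green_dom_E nu Hphi.
  exists phi; split=> //; first by rewrite Gphi; exact: dom_EZ.
  move=> f [Hf _]; rewrite (nu_form_sym nu f) -(I1_green nu Hphi Hf) I1_sym.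
  by rewrite {1}Gphi (I1Zl _ dG.1 Hf).
- exists u; split=> //; rewrite T_nuE//.
  have dG := green_dom_E nu Hu; have [HG _] := dG.
  have dU : dom_E nu (fun x => - lambda * u x) by apply: dom_EZ.
  have dD := dom_ED dG dU.
  have [HU _] := dU; have [HD _] := dD.
  have : green nu u \+ (fun x => - lambda * u x) = cst 0.
    apply: I1_definite => //.
    rewrite (I1Dl HG HU HD) (I1Zl _ Hu HD) (I1_green nu Hu HD) I1_sym (uE _ dD).
    by rewrite (nu_form_sym nu u) mulNr mulVKf// subrr.
  move=> D0; apply/funext => x; have /= := congr1 (fun f => f x) D0.
  by rewrite mulNr => /eqP; rewrite subr_eq0 => /eqP.
Qed.
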